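(* Let $\mu_1,\dots,\mu_n\in\mathbb R^d$, let $\Sigma\in\mathbb R^{d\times d}$ be positive definite, let $w_1,\dots,w_n>0$ with $\sum_{i=1}^n w_i=1$, and let $$f(x)=-\log\Big\{\sum_{i=1}^n w_i e^{-\frac12(x-\mu_i)^\top\Sigma^{-1}(x-\mu_i)}\Big\},\qquad x\in\mathbb R^d.$$ Let $P^*$ be the probability distribution on $\mathbb R^d$ with density $p^*(x)\propto e^{-f(x)}$. Define $$D=\max\Big\{\max_{k\in[n]}\|\mu_k\|,\sqrt{\gamma_{\min}}\Big\},\qquad w_{\min}=\min_{1\le j\le n}w_j,\qquad \kappa=\frac{\gamma_{\max}}{\gamma_{\min}},$$ where $\gamma_{\max}$ and $\gamma_{\min}$ denote the largest and smallest eigenvalues of $\Sigma$. Then, assuming $d$ is fixed, the simulated tempering Metropolis--Hastings (STMH) algorithm can be used to generate a sample from a distribution that is within $\varepsilon$ total variation distance of the target distribution $P^*$, in time $$\operatorname{poly}\Big(\frac1{w_{\min}},D,\kappa\Big)\cdot\log^3\Big(\frac1\varepsilon\Big).$$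
   Context: $[n]=\{1,\dots,n\}$. Total variation distance: $\|\Pi_1-\Pi_2\|_{\mathrm{tv}}=\int|\pi_1(x)-\pi_2(x)|\,dx\in[0,2]$ for distributions with densities $\pi_1,\pi_2$. The number $\varepsilon$ is the target accuracy in total variation distance. Access model: $f$ can be evaluated at any point $x\in\mathbb R^d$, but the individual means $\mu_i$ and weights $w_i$ are not accessible. Time is counted in simulated tempering steps, summed over all runs, and includes the estimation of the partition functions described below. STMH run with $\ell$ levels. Inputs: $f$, inverse temperatures $0<\beta_1<\dots<\beta_\ell$, partition function estimates $\widehat Z_1,\dots,\widehat Z_\ell$, number of steps $N$, step size $\eta>0$, rate $\lambda\in(0,1)$, initial covariance $\Sigma_0$. Draw $x\sim\mathcal N(0,\Sigma_0)$ and set $i=1$. Repeat $N$ times: with probability $1-\lambda$, propose $x'\sim\mathcal N(x,\eta I)$ and replace $x$ by $x'$ with probability $\min\{1,e^{-\beta_if(x')}/e^{-\beta_if(x)}\}$; with probability $\lambda$, propose $i'=i\pm1$ with probability $1/2$ each and, if $1\le i'\le\ell$, replace $i$ by $i'$ with probability $\min\Big\{1,\frac{e^{-\beta_{i'}f(x)}/\widehat Z_{i'}}{e^{-\beta_if(x)}/\widehat Z_i}\Big\}$. Return the final $(x,i)$. Full algorithm. Use inverse temperatures $0<\beta_1<\dots<\beta_L=1$. Set $\widehat Z_1=1$. For $\ell=1,\dots,L-1$: run the $\ell$-level STMH repeatedly until $s$ samples $x_1,\dots,x_s$ are obtained at temperature level $\ell$, and set $\widehat Z_{\ell+1}=\frac{\widehat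 Z_\ell}{s}\sum_{j=1}^s e^{(-\beta_{\ell+1}+\beta_\ell)f(x_j)}$. Finally run the $L$-level STMH (re-running if the returned state is not at level $L$) and use a sample collected at level $L$ as the sample from the (approximate) target. The algorithm parameters (number of levels, inverse temperatures, step size, rate, initial covariance, numbers of steps and samples) are to be chosen suitably.
   Formalization: The time bound uses D/√γ_min in place of D (with D itself it fails, e.g. means ±1, Σ→0 in dimension 1), and log(1/ε) is read as log max(2,1/ε); the time bound holds with probability at least 1−ε. *)

(* Defs.v *)
From HB Require Import structures.
From mathcomp Require Import all_boot all_order all_algebra.
From mathcomp Require Import all_classical all_reals all_analysis.

Set Implicit Arguments.
Unset Strict Implicit.
Unset Printing Implicit Defensive.

Import Order.TTheory GRing.Theory Num.Theory.
Import numFieldNormedType.Exports.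

Local Open Scope classical_set_scope.
Local Open Scope ring_scope.

(* Points of R^d are d-tuples, which carry the product (Borel) sigma-algebra. *)
Notation point R d := (d.-tuple (measurableTypeR R)).

Section lebesgue_tuple.
Variable R : realType.

Definition tuple_cons n (p : measurableTypeR R * point R n) : point R n.+1 :=
  [the n.+1.-tuple _ of p.1 :: p.2].

Lemma measurable_tuple_cons n : measurable_fun setT (@tuple_cons n).
Proof. exact: measurable_cons. Qed.

Definition tuple_uncons n (t : point R n.+1) : measurableTypeR R * point R n :=
  (thead t, [tuple of behead t]).

Lemma measurable_tuple_uncons n : measurable_fun setT (@tuple_uncons n).
Proof.
apply/measurable_fun_pairP; split; first exact: measurable_tnth.
exact: measurable_behead.
Qed.

Lemma tuple_consK n : cancel (@tuple_cons n) (@tuple_uncons n).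
Proof. by case=> a t; congr (_, _); apply/val_inj. Qed.

Lemma tuple_unconsK n : cancel (@tuple_uncons n) (@tuple_cons n).
Proof. by move=> t; rewrite /tuple_cons/= [RHS]tuple_eta. Qed.

Section step.
Variables (n : nat) (m : {sigma_finite_measure set (point R n) -> \bar R}).

Definition lebesgue_cons : set (point R n.+1) -> \bar R :=
  pushforward (@lebesgue_measure R \x m)%E (@tuple_cons n).

HB.instance Definition _ := Measure.copy lebesgue_cons
  (measure_function_pushforward__canonical__measure_function_Measure
    (@lebesgue_measure R \x m)%E (@measurable_tuple_cons n)).

Let lebesgue_cons_sigma_finite : sigma_finite setT lebesgue_cons.
Proof.
have /sigma_finiteP[F [FT ndF Ffin]] := sigma_finiteT (@lebesgue_measure R).
have /sigma_finiteP[G [GT ndG Gfin]] := sigma_finiteT m.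
exists (fun i => @tuple_uncons n @^-1` (F i `*` G i)).
  apply/seteqP; split=> // t _.
  have [i _ Fi] : (\bigcup_i F i) (thead t) by rewrite -FT.
  have [j _ Gj] : (\bigcup_i G i) [tuple of behead t] by rewrite -GT.
  exists (maxn i j) => //; split=> /=.
    by move: Fi; apply/subsetPset/ndF/leq_maxl.
  by move: Gj; apply/subsetPset/ndG/leq_maxr.
move=> i; have [mF Foo] := Ffin i; have [mG Goo] := Gfin i; split.
  rewrite -[X in measurable X]setTI; apply: measurable_tuple_uncons => //.
  exact: measurableX.
rewrite /lebesgue_cons /pushforward (_ : _ @^-1` _ = F i `*` G i); last first.
  apply/funext => p.
  by change ((F i `*` G i) (tuple_uncons (tuple_cons p)) = (F i `*` G i) p);
     rewrite tuple_consK.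
by rewrite product_measure1E// lte_mul_pinfty// ge0_fin_numE.
Qed.

HB.instance Definition _ :=
  Measure_isSigmaFinite.Build _ _ _ lebesgue_cons lebesgue_cons_sigma_finite.

End step.

(* d-dimensional Lebesgue measure. *)
Fixpoint lebesgue_tuple d : {sigma_finite_measure set (point R d) -> \bar R} :=
  match d with
  | 0 => \d_([tuple] : point R 0)
  | d'.+1 => lebesgue_cons (lebesgue_tuple d')
  end.

End lebesgue_tuple.

Section linear_algebra.
Variables (R : realType) (d : nat).
Implicit Types (A : 'M[R]_d) (v : 'cV[R]_d).

Definition qform A v : R := (v^T *m A *m v) 0 0.

Definition posdef A : Prop := A^T = A /\ forall v, v != 0 -> 0 < qform A v.

Definition enorm v : R := Num.sqrt (\sum_i v i 0 ^+ 2).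

(* For 0 < d and A symmetric the spectrum is finite and nonempty, so that these
   are the largest and smallest eigenvalues. *)
Definition gamma_max A : R := sup [set a | eigenvalue A a].
Definition gamma_min A : R := inf [set a | eigenvalue A a].

Definition condition_number A : R := gamma_max A / gamma_min A.

Definition col_of (x : point R d) : 'cV[R]_d := \col_i tnth x i.

Definition gauss_pdf (m : 'cV[R]_d) (S : 'M[R]_d) (x : point R d) : R :=
  expR (- (qform (invmx S) (col_of x - m) / 2)) /
  Num.sqrt ((2 * pi) ^+ d * \det S).

End linear_algebra.

Section mixture.
Variables (R : realType) (d n : nat).
Variables (mu : 'I_n -> 'cV[R]_d) (Sigma : 'M[R]_d) (w : 'I_n -> R).

Definition mixture_potential (x : point R d) : R :=
  - ln (\sum_i w i * expR (- (qform (invmx Sigma) (col_of x - mu i) / 2))).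

(* A length, whereas the law of the number of steps is unchanged when mu, sqrt
   Sigma and the proposals are rescaled together: a running time depends on it
   only relatively to another length, such as sqrt (gamma_min Sigma). *)
Definition mixture_radius : R :=
  Num.max (\big[Num.max/0]_i enorm (mu i)) (Num.sqrt (gamma_min Sigma)).

(* The initial value 1 is harmless: the weights are at most 1. *)
Definition min_weight : R := \big[Num.min/1]_i w i.

End mixture.

Section target.
Variables (R : realType) (d : nat) (f : point R d -> R).

Definition target_pdf (x : point R d) : R :=
  expR (- f x) / fine (\int[lebesgue_tuple R d]_y (expR (- f y))%:E).

End target.

(* A randomized computation with result in T is represented by its expectation
   functional, mapping a nonnegative g to the expectation of g(result), with
   contribution 0 from the executions that do not terminate. *)
Section prog.
Variable R : realType.

Definition prog (T : Type) := (T -> \bar R) -> \bar R.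

Definition ret T (x : T) : prog T := fun g => g x.

Definition bind T U (M : prog T) (k : T -> prog U) : prog U :=
  fun g => M (fun x => k x g).

Definition choose T (p : R) (M1 M2 : prog T) : prog T :=
  fun g => (p%:E * M1 g + (1 - p)%:E * M2 g)%E.

Definition diverge T : prog T := fun _ => 0%E.

(* Supremum of an increasing sequence of approximations: the meaning of an
   unbounded loop whose k-th approximation performs at most k iterations. *)
Definition limit T (M : nat -> prog T) : prog T :=
  fun g => ereal_sup (range (fun k => M k g)).

Definition gauss d (m : 'cV[R]_d) (S : 'M[R]_d) : prog (point R d) :=
  fun g => (\int[lebesgue_tuple R d]_x ((gauss_pdf m S x)%:E * g x))%E.

Definition prob T (M : prog T) (A : set T) : \bar R :=
  M (fun x => (\1_A x)%:E).

End prog.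

(* Levels are numbered from 1: beta, and the estimates Z below, are only used at
   indices 1, ..., levels. *)
Record stmh_params (R : realType) (d : nat) := StmhParams {
  levels : nat;
  beta : nat -> R;
  stepsize : R;
  rate : R;
  cov0 : 'M[R]_d;
  nsteps : nat;
  nsamples : nat
}.

Definition valid_params (R : realType) (d : nat) (P : stmh_params R d) : Prop :=
  [/\ [/\ (0 < levels P)%N, 0 < beta P 1, beta P (levels P) = 1 &
          forall i, (0 < i < levels P)%N -> beta P i < beta P i.+1],
      0 < stepsize P, 0 < rate P < 1, posdef (cov0 P) & (0 < nsamples P)%N].

Section algorithm.
Variables (R : realType) (d : nat) (f : point R d -> R) (P : stmh_params R d).

Definition gibbs (i : nat) (x : point R d) : R := expR (- beta P i * f x).

Definition position_move (z : point R d * nat) : prog R (point R d * nat) :=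
  let: (x, i) := z in
  bind (gauss (col_of x) (stepsize P)%:M) (fun x' =>
    choose (Num.min 1 (gibbs i x' / gibbs i x)) (ret (x', i)) (ret (x, i))).

Section run.
Variables (ell : nat) (Z : nat -> R).

Definition level_try (z : point R d * nat) (i' : nat) :
    prog R (point R d * nat) :=
  let: (x, i) := z in
  if (1 <= i' <= ell)%N then
    choose (Num.min 1 ((gibbs i' x / Z i') / (gibbs i x / Z i)))
      (ret (x, i')) (ret (x, i))
  else ret (x, i).

Definition level_move (z : point R d * nat) : prog R (point R d * nat) :=
  choose 2^-1 (level_try z z.2.+1) (level_try z z.2.-1).

Definition stmh_step (z : point R d * nat) : prog R (point R d * nat) :=
  choose (rate P) (level_move z) (position_move z).

Definition stmh_run : prog R (point R d * nat) :=
  iter (nsteps P) (fun M => bind M stmh_step)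
    (bind (gauss 0 (cov0 P)) (fun x => ret (x, 1%N))).

(* At most k runs are made, until s more samples are obtained at level ell; xs
   holds the samples already collected and t the number of steps already spent. *)
Fixpoint collect_upto (k s : nat) (xs : seq (point R d)) (t : nat) :
    prog R (seq (point R d) * nat) :=
  match s, k with
  | 0, _ => ret (xs, t)
  | _.+1, 0 => @diverge R _
  | s'.+1, k'.+1 =>
      bind stmh_run (fun z =>
        if z.2 == ell then collect_upto k' s' (rcons xs z.1) (t + nsteps P)
        else collect_upto k' s xs (t + nsteps P))
  end.

Definition collect (s : nat) : prog R (seq (point R d) * nat) :=
  limit (fun k => collect_upto k s [::] 0).

End run.

Definition next_estimate (m : nat) (Z : nat -> R) (xs : seq (point R d)) : R :=
  Z m / (nsamples P)%:R *
  \sum_(x <- xs) expR ((- beta P m.+1 + beta P m) * f x).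

(* Estimates for the levels 1, ..., m.+1, with the number of steps spent. *)
Fixpoint estimate (m : nat) : prog R ((nat -> R) * nat) :=
  match m with
  | 0 => ret ((fun=> 1), 0%N)
  | m'.+1 =>
      bind (estimate m') (fun '(Z, t) =>
      bind (collect m Z (nsamples P)) (fun '(xs, t') =>
        ret ((fun i => if i == m.+1 then next_estimate m Z xs else Z i),
               (t + t')%N)))
  end.

(* The sample returned by the full algorithm, and the total number of steps. *)
Definition stmh_algorithm : prog R (point R d * nat) :=
  bind (estimate (levels P).-1) (fun '(Z, t) =>
  bind (collect (levels P) Z 1) (fun '(xs, t') =>
    ret (head [tuple of nseq d 0] xs, (t + t')%N))).

End algorithm.

(* The result of M has a density, within eps of p in total variation. *)
Definition generates_within (R : realType) (d : nat)
    (M : prog R (point R d * nat)) (p : point R d -> R) (eps : R) : Prop :=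
  exists q : point R d -> R,
    [/\ measurable_fun setT q, forall x, 0 <= q x,
        (\int[lebesgue_tuple R d]_x (q x)%:E)%E = 1%E,
        forall A, measurable A ->
          prob M [set z | A z.1] = (\int[lebesgue_tuple R d]_(x in A) (q x)%:E)%E &
        (\int[lebesgue_tuple R d]_x `|q x - p x|%:E <= eps%:E)%E].

(* The running time is random, because runs are repeated until they end at the
   required level; time exceeding t is allowed with probability eps, at the same
   scale as the error allowed on the sample. *)
Definition runs_in_time (R : realType) (T : Type) (M : prog R (T * nat))
    (t eps : R) : Prop :=
  ((1 - eps)%:E <= prob M [set z : T * nat | (z.2%:R <= t)%R])%E.

Definition eval3 (R : realType) (p : {poly {poly {poly R}}}) (a b c : R) : R :=
  p.[a%:P%:P].[b%:P].[c].

(* Main.v *)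
(* In fixed dimension a single level is enough. With proposals N(x, r^2 I) on the
   scale r of the whole mixture, the Metropolis-Hastings chain started from a
   narrow Gaussian at the origin already converges geometrically, at a rate
   polynomial in the parameters: r / sqrt(gamma_min) is polynomial in D and kappa,
   and only the exponent depends on d.

   Inside a ball of radius r the proposal density is bounded below. Outside it,
   with polynomially small probability the proposal is a small perturbation of a
   move towards the origin, which multiplies the density exp(-f) by a large
   factor E. For g := phi - c and a point x outside the ball, the square g(x)^2 is
   compared with (g(x) - g(y))^2 and g(y)^2 for such proposals y; since
   exp(-f(x)) <= exp(-f(y)) / E, the second terms sum up to a small fraction of
   the integral of g^2 against the target. This gives a Poincare inequality, hence
   exponential decay of the chi-square distance of the lazy reversible chain,
   which bounds the total variation distance. The initial chi-square distance is
   at most exponential in the parameters. As there is one level, every run ends at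
   the required level and the running time is deterministic. *)
From Pilot Require Import Defs.
From mathcomp Require Import all_boot all_order all_algebra.
From mathcomp Require Import all_classical all_reals all_analysis.
From mathcomp Require Import measurable_realfun.
From mathcomp Require Import ring lra.

Set Implicit Arguments.
Unset Strict Implicit.
Unset Printing Implicit Defensive.

Import Order.TTheory GRing.Theory Num.Theory.
Import numFieldNormedType.Exports.
Import Pilot.Defs.

Local Open Scope classical_set_scope.
Local Open Scope ring_scope.

(** * Weighted integrals of bounded functions *)

(** A program is an expectation functional, so a step acts on test functions. On functions with
    values in [0, M] it acts as [lazy_step], whose formula involves only the density of accepted
    moves, although rejections give the law of a step an atom. Reversibility moves the iterates from
    the test function to the initial density relative to the target, and this is how the output gets
    a density. The price is that this relative density must be bounded, whence an initial Gaussian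
    narrower than the components.

    The tension is in the moves from outside the core: their probability must be at least four times
    the inverse of the factor by which they raise the density. With b := [shrink_const], the
    admissible perturbation b D / 2 and the proposal scale r are both proportional to b D, so
    [escape_const] does not depend on b, while the gain expR (2 b^2 kappa^2) does; b can be fixed
    last. The time found is linear in log (1 / eps), and is then bounded by the cube. *)

Section bounded_measurable.
Context d (T : measurableType d) (R : realType).
Implicit Types f g : T -> R.

(** A class closed under the algebra used below and integrable against every integrable weight, so
    that real-valued integrals are linear without further side conditions. *)
Definition bmeas f := measurable_fun setT f /\ exists M, forall x, `|f x| <= M.

Lemma bmeas_cst (c : R) : bmeas (fun=> c).
Proof. by split; [exact: measurable_cst|exists `|c|]. Qed.

Lemma bmeasD f g : bmeas f -> bmeas g -> bmeas (fun x => f x + g x).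
Proof.
move=> [mf [M fM]] [mg [N gN]]; split; first exact: measurable_funD.
by exists (M + N) => x; rewrite (le_trans (ler_normD _ _))// lerD.
Qed.

Lemma bmeasM f g : bmeas f -> bmeas g -> bmeas (fun x => f x * g x).
Proof.
move=> [mf [M fM]] [mg [N gN]]; split; first exact: measurable_funM.
by exists (M * N) => x; rewrite normrM ler_pM.
Qed.

Lemma bmeasZ c f : bmeas f -> bmeas (fun x => c * f x).
Proof. by move=> ?; apply: bmeasM => //; exact: bmeas_cst. Qed.

Lemma bmeasB f g : bmeas f -> bmeas g -> bmeas (fun x => f x - g x).
Proof.
move=> bf bg; rewrite (_ : (fun x => _) = (fun x => f x + -1 * g x)).
  by apply: bmeasD => //; exact: bmeasZ.
by apply/funext => x; rewrite mulN1r.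
Qed.

Lemma bmeasX n f : bmeas f -> bmeas (fun x => f x ^+ n).
Proof.
move=> [mf [M fM]]; split; first exact: measurable_funX.
exists (M ^+ n) => x; rewrite normrX; apply: lerXn2r => //; rewrite nnegrE//.
exact: le_trans (fM x).
Qed.

Lemma bmeas_norm f : bmeas f -> bmeas (fun x => `|f x|).
Proof.
move=> [mf [M fM]]; split; first exact: measurableT_comp.
by exists M => x; rewrite normr_id.
Qed.

Lemma bmeas_ge0 f M : measurable_fun setT f -> (forall x, 0 <= f x <= M) ->
  bmeas f.
Proof.
move=> mf fM; split=> //; exists M => x.
by have /andP[f0 ?] := fM x; rewrite ger0_norm.
Qed.

Lemma bmeas_indic (A : set T) : measurable A -> bmeas (\1_A : T -> R).
Proof.
move=> mA; apply: (@bmeas_ge0 _ 1); first exact: measurable_indic.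
by move=> x; rewrite indicE; case: (_ \in _); rewrite /= ?lexx ?ler01.
Qed.

Lemma ge0_integrable (m : {measure set T -> \bar R}) f :
  measurable_fun setT f -> (forall x, 0 <= f x) ->
  (\int[m]_x (f x)%:E < +oo)%E -> m.-integrable setT (EFin \o f).
Proof.
move=> mf f0 foo; apply/integrableP; split; first exact/measurable_EFinP.
by under eq_integral do rewrite /= ger0_norm//.
Qed.

Section weighted.
Variables (m : {measure set T -> \bar R}) (w : T -> R).
Hypothesis iw : m.-integrable setT (EFin \o w).

Lemma weighted_integrable f : bmeas f ->
  m.-integrable setT (EFin \o (fun x => w x * f x)).
Proof.
move=> [mf [M fM]].
rewrite (_ : _ \o _ = (EFin \o w) \* (EFin \o f))%E; last first.
  by apply/funext => x /=; rewrite EFinM.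
apply: integrableMl => //.
by exists M; split; [exact: num_real|move=> y My x _; apply: le_trans (ltW My)].
Qed.

Lemma weightedD f g : bmeas f -> bmeas g ->
  \int[m]_x (w x * (f x + g x)) =
  \int[m]_x (w x * f x) + \int[m]_x (w x * g x).
Proof.
move=> bf bg; rewrite -RintegralD//; [|exact: weighted_integrable..].
by apply: eq_Rintegral => x _; rewrite mulrDr.
Qed.

Lemma weightedB f g : bmeas f -> bmeas g ->
  \int[m]_x (w x * (f x - g x)) =
  \int[m]_x (w x * f x) - \int[m]_x (w x * g x).
Proof.
move=> bf bg; rewrite -RintegralB//; [|exact: weighted_integrable..].
by apply: eq_Rintegral => x _; rewrite mulrBr.
Qed.

Lemma weightedZ c f : bmeas f ->
  \int[m]_x (w x * (c * f x)) = c * \int[m]_x (w x * f x).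
Proof.
move=> bf; rewrite -RintegralZl//; last exact: weighted_integrable.
by apply: eq_Rintegral => x _; rewrite mulrCA.
Qed.

Lemma EFin_weighted f : bmeas f ->
  (\int[m]_x (w x * f x))%:E = (\int[m]_x (w x * f x)%:E)%E.
Proof.
move=> bf; rewrite /Rintegral fineK//.
exact: (integrable_fin_num _ (weighted_integrable bf)).
Qed.

Hypothesis w0 : forall x, 0 <= w x.

Lemma le_weighted f g : bmeas f -> bmeas g -> (forall x, f x <= g x) ->
  \int[m]_x (w x * f x) <= \int[m]_x (w x * g x).
Proof.
move=> bf bg fg; apply: le_Rintegral => //; [exact: weighted_integrable..|].
by move=> x _; rewrite ler_wpM2l.
Qed.

(* The variance is nonnegative. *)
Lemma weighted_jensen f : bmeas f -> \int[m]_x w x <= 1 ->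
  (\int[m]_x (w x * f x)) ^+ 2 <= \int[m]_x (w x * f x ^+ 2).
Proof.
move=> bf w1; set c := \int[m]_x _; set b := \int[m]_x _ in w1 *.
have bb := bmeasX 2 bf; have bc := bmeasZ (2 * c) bf.
have H : 0 <= \int[m]_x (w x * (f x - c) ^+ 2).
  by apply: Rintegral_ge0 => x _; rewrite mulr_ge0// sqr_ge0.
have : \int[m]_x (w x * (f x - c) ^+ 2) =
   \int[m]_x (w x * f x ^+ 2) - (2 * c) * c + c ^+ 2 * b.
  have -> : c ^+ 2 * b = \int[m]_x (w x * (c ^+ 2 * 1)).
    rewrite (weightedZ (c ^+ 2) (f := fun=> 1)); last exact: bmeas_cst.
    by congr (_ * _); apply: eq_Rintegral => x _; rewrite mulr1.
  rewrite -[(2 * c) * c]weightedZ// -weightedB// -weightedD//.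
  - by apply: eq_Rintegral => x _; ring.
  - exact: bmeasB.
  - exact: bmeas_cst.
move=> E; move: H; rewrite E => H.
(* The weight may have mass b below 1, as a kernel with rejections does; the deficit only helps. *)
have : c ^+ 2 * b <= c ^+ 2 by rewrite ler_piMr// sqr_ge0.
lra.
Qed.

End weighted.

End bounded_measurable.

Lemma bmeas_comp d1 d2 (T1 : measurableType d1) (T2 : measurableType d2)
    (R : realType) (f : T2 -> R) (g : T1 -> T2) :
  bmeas f -> measurable_fun setT g -> bmeas (f \o g).
Proof.
by move=> [mf [M fM]] mg; split; [exact: measurableT_comp|exists M => x /=].
Qed.

(** * Lazy reversible chains with a transition density *)

Section reversible_chain.
Context d (T : measurableType d) (R : realType).
Variables (mu : {sigma_finite_measure set T -> \bar R}).
Variables (p : T -> R) (k : T * T -> R).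
Hypotheses (mp : measurable_fun setT p) (p0 : forall x, 0 <= p x).
Hypothesis p1 : (\int[mu]_x (p x)%:E = 1)%E.
Hypotheses (mk : measurable_fun setT k) (k0 : forall z, 0 <= k z).
(** The missing mass is the probability that the proposal is rejected. *)
Hypothesis k1 : forall x, (\int[mu]_y (k (x, y))%:E <= 1)%E.
Hypothesis balance : forall x y, p x * k (x, y) = p y * k (y, x).

Let ip : mu.-integrable setT (EFin \o p).
Proof. by apply: ge0_integrable => //; rewrite p1 ltey. Qed.

Let mk_section x : measurable_fun setT (fun y => k (x, y)).
Proof. exact: measurableT_comp mk (measurable_pair1 x). Qed.

Let ik x : mu.-integrable setT (EFin \o (fun y => k (x, y))).
Proof.
by apply: ge0_integrable => //; rewrite (le_lt_trans (k1 x))// ltey.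
Qed.

Let k1R x : \int[mu]_y k (x, y) <= 1.
Proof.
rewrite -lee_fin /Rintegral fineK ?k1//.
exact: (integrable_fin_num _ (ik x)).
Qed.

(** The stationary law of a pair (state, accepted next state); by [balance] it is symmetric. *)
Definition pair_weight (z : T * T) : R := p z.1 * k z.

Let w0 z : 0 <= pair_weight z.
Proof. by rewrite mulr_ge0. Qed.

Let mw : measurable_fun setT pair_weight.
Proof. by apply: measurable_funM => //; exact: measurableT_comp. Qed.

Lemma pair_weight_integrable :
  (mu \x mu)%E.-integrable setT (EFin \o pair_weight).
Proof.
apply/integrable12ltyP; first exact/measurable_EFinP.
apply: (@le_lt_trans _ _ 1%E); last by rewrite ltey.
rewrite -p1; apply: ge0_le_integral => //=.
- by move=> x _; exact: integral_ge0.
- apply: (measurable_fun_fubini_tonelli_F (m2 := mu)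
    (fun z : T * T => (`|pair_weight z|)%:E)) => //.
  by apply/measurable_EFinP; exact: measurableT_comp.
- exact/measurable_EFinP.
move=> x _; under eq_integral do rewrite ger0_norm// /pair_weight/= EFinM.
rewrite ge0_integralZl//=.
- by rewrite -[leRHS]mule1 lee_wpmul2l// lee_fin.
- exact/measurable_EFinP.
- by move=> y _; rewrite lee_fin.
- by rewrite lee_fin.
Qed.

Let iw := pair_weight_integrable.

Definition pair_integral (F : T * T -> R) : R :=
  \int[(mu \x mu)%E]_z (pair_weight z * F z).

Lemma pair_integral_fubini (F : T * T -> R) : bmeas F ->
  pair_integral F = \int[mu]_x (p x * \int[mu]_y (k (x, y) * F (x, y))).
Proof.
move=> bF; rewrite /pair_integral {1}/Rintegral.
rewrite -(integral12_prod_meas1 (weighted_integrable iw bF)).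
congr fine; apply: eq_integral => x _; rewrite /fubini_F /=.
under eq_integral do rewrite /pair_weight -mulrA EFinM.
have bFx : bmeas (fun y => F (x, y)).
  exact: (bmeas_comp bF (measurable_pair1 x)).
rewrite EFinM (EFin_weighted (ik x) bFx).
by rewrite -integralZl//; exact: (weighted_integrable (ik x) bFx).
Qed.

Let bmeas_swap (F : T * T -> R) : bmeas F -> bmeas (fun z => F (z.2, z.1)).
Proof. by move=> bF; exact: (bmeas_comp bF (@measurable_swap _ _ T T)). Qed.

Lemma pair_integral_swap (F : T * T -> R) : bmeas F ->
  pair_integral (fun z => F (z.2, z.1)) = pair_integral F.
Proof.
move=> bF; have bF' := bmeas_swap bF.
rewrite /pair_integral /Rintegral.
rewrite -(integral12_prod_meas1 (weighted_integrable iw bF')).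
rewrite -(integral21_prod_meas1 (weighted_integrable iw bF)).
congr fine; apply: eq_integral => x _; apply: eq_integral => y _.
by rewrite /= /pair_weight/= balance.
Qed.

(* The jump part of the generator; rejected proposals do not contribute to it. *)
Definition flow (phi : T -> R) (x : T) : R :=
  \int[mu]_y (k (x, y) * (phi y - phi x)).

Let bshift (phi : T -> R) x : bmeas phi -> bmeas (fun y => phi y - phi x).
Proof. by move=> ?; apply: bmeasB => //; exact: bmeas_cst. Qed.

Lemma flowE (phi : T -> R) x : bmeas phi ->
  flow phi x = \int[mu]_y (k (x, y) * phi y) - phi x * \int[mu]_y k (x, y).
Proof.
move=> bphi; rewrite /flow (weightedB (ik x) bphi (bmeas_cst _ _)).
by congr (_ - _); rewrite RintegralZr// mulrC.
Qed.

(** Nonnegativity of [F] gives measurability in x through Tonelli's theorem. *)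
Lemma bmeas_kernel_integral (F : T * T -> R) N :
  measurable_fun setT F -> (forall z, 0 <= F z <= N) ->
  bmeas (fun x => \int[mu]_y (k (x, y) * F (x, y))).
Proof.
move=> mF FN; have bF := bmeas_ge0 mF FN.
have F0 z : 0 <= F z by have /andP[] := FN z.
have bFx x : bmeas (fun y => F (x, y)).
  exact: (bmeas_comp bF (measurable_pair1 x)).
apply: (@bmeas_ge0 _ _ _ _ N).
  apply: measurableT_comp => //.
  apply: (measurable_fun_fubini_tonelli_F (m2 := mu)
     (fun z : T * T => (k z * F z)%:E)).
    by apply/measurable_EFinP; apply: measurable_funM.
  by move=> z; rewrite lee_fin mulr_ge0.
move=> x; have N0 : 0 <= N by have /andP[a b] := FN (x, x); exact: le_trans a b.
apply/andP; split; first by apply: Rintegral_ge0 => y _; rewrite mulr_ge0.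
apply: (@le_trans _ _ (\int[mu]_y (k (x, y) * N))).
  apply: (le_weighted (ik x)) => //; first exact: bmeas_cst.
  by move=> y; have /andP[] := FN (x, y).
by rewrite RintegralZr// ler_piMl.
Qed.

Section bounded.
Variables (M : R) (phi : T -> R).
Hypotheses (mphi : measurable_fun setT phi) (phiM : forall x, 0 <= phi x <= M).

Let bphi : bmeas phi. Proof. exact: bmeas_ge0 phiM. Qed.

Let phi0 x : 0 <= phi x. Proof. by have /andP[] := phiM x. Qed.

Lemma measurable_flow : measurable_fun setT (flow phi).
Proof.
rewrite (_ : flow phi = fun x => \int[mu]_y (k (x, y) * phi y) -
   phi x * \int[mu]_y k (x, y)); last by apply/funext => x; exact: flowE.
apply: measurable_funB.
  have mphi2 := measurableT_comp mphi (@measurable_snd _ _ T T).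
  by have [] := @bmeas_kernel_integral (phi \o snd) M mphi2 (fun z => phiM z.2).
apply: measurable_funM => //.
under eq_fun do under eq_Rintegral do rewrite -[k _]mulr1.
have b1 : bmeas (fun x => \int[mu]_y (k (x, y) * 1)).
  apply: (@bmeas_kernel_integral (fun=> 1) 1); first exact: measurable_cst.
  by move=> z; rewrite ler01 lexx.
by case: b1.
Qed.

Lemma flow_bounds x : - phi x <= flow phi x <= M - phi x.
Proof.
have /andP[_ pM] := phiM x.
have K0 : 0 <= \int[mu]_y k (x, y) by exact: Rintegral_ge0.
have I0 : 0 <= \int[mu]_y (k (x, y) * phi y).
  by apply: Rintegral_ge0 => y _; rewrite mulr_ge0.
have IM : \int[mu]_y (k (x, y) * phi y) <= M * \int[mu]_y k (x, y).
  apply: (@le_trans _ _ (\int[mu]_y (k (x, y) * M))).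
    apply: (le_weighted (ik x)) => //; first exact: bmeas_cst.
    by move=> y; have /andP[] := phiM y.
  by rewrite RintegralZr// mulrC.
rewrite flowE//; apply/andP; split.
  have : phi x * \int[mu]_y k (x, y) <= phi x by rewrite ler_piMr.
  lra.
have : (M - phi x) * \int[mu]_y k (x, y) <= M - phi x.
  by rewrite ler_piMr// subr_ge0.
rewrite mulrBl; lra.
Qed.

Lemma bmeas_flow : bmeas (flow phi).
Proof.
split; first exact: measurable_flow.
exists M => x; have := flow_bounds x; have /andP[] := phiM x.
move=> ? ? /andP[? ?]; rewrite ler_norml; apply/andP; split; lra.
Qed.

(** The mean of [phi] after a step that stays put with probability 1/2 and otherwise makes a
    Metropolis move, whose mean is [phi x + flow phi x]. *)
Definition lazy_step (x : T) : R := phi x + flow phi x / 2.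

Lemma measurable_lazy_step : measurable_fun setT lazy_step.
Proof.
apply: measurable_funD => //; apply: measurable_funM => //.
exact: measurable_flow.
Qed.

Lemma lazy_step_bounds x : 0 <= lazy_step x <= M.
Proof.
have := flow_bounds x; have /andP[] := phiM x; rewrite /lazy_step.
move=> ? ? /andP[? ?]; apply/andP; split; lra.
Qed.

(** Integration by parts: the weight of pairs is invariant under swapping, so the integrand may be
    averaged over (x, y) and (y, x), which symmetrizes the factor [psi]. *)
Lemma flow_form (psi : T -> R) : bmeas psi ->
  \int[mu]_x (p x * (psi x * flow phi x)) =
  - pair_integral (fun z => (psi z.2 - psi z.1) * (phi z.2 - phi z.1)) / 2.
Proof.
move=> bpsi.
have b1 (f : T -> R) : bmeas f -> bmeas (fun z : T * T => f z.1).
  by move=> bf; exact: (bmeas_comp bf (@measurable_fst _ _ T T)).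
have b2 (f : T -> R) : bmeas f -> bmeas (fun z : T * T => f z.2).
  by move=> bf; exact: (bmeas_comp bf (@measurable_snd _ _ T T)).
pose F (z : T * T) := psi z.1 * (phi z.2 - phi z.1).
have bF : bmeas F.
  by apply: bmeasM; [exact: b1|apply: bmeasB; [exact: b2|exact: b1]].
have -> : \int[mu]_x (p x * (psi x * flow phi x)) = pair_integral F.
  rewrite pair_integral_fubini//; apply: eq_Rintegral => x _; congr (_ * _).
  by rewrite /F/= weightedZ//; exact: bshift.
have E : pair_integral F + pair_integral F = - pair_integral
    (fun z => (psi z.2 - psi z.1) * (phi z.2 - phi z.1)).
  rewrite -{1}pair_integral_swap// -[RHS]mulN1r.
  have bF' := bmeas_swap bF.
  rewrite -(weightedZ iw); last first.
    by apply: bmeasM; apply: bmeasB; [exact: b2|exact: b1|exact: b2|exact: b1].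
  rewrite -(weightedD iw)//; apply: eq_Rintegral => z _; congr (_ * _).
  by rewrite /F /=; ring.
lra.
Qed.

(** Twice the usual Dirichlet form of the chain that is not lazy. *)
Definition dirichlet : R :=
  pair_integral (fun z => (phi z.1 - phi z.2) ^+ 2).

(** The chi-square distance to [p] of the law with density [phi] relative to [p], when that law has
    mass 1. *)
Definition deviation : R := \int[mu]_x (p x * (phi x - 1) ^+ 2).

End bounded.

(** By [flow_form], both sides reduce to expressions symmetric in [phi] and [psi]. *)
Lemma lazy_step_selfadjoint M N (phi psi : T -> R) :
  measurable_fun setT phi -> (forall x, 0 <= phi x <= M) ->
  measurable_fun setT psi -> (forall x, 0 <= psi x <= N) ->
  \int[mu]_x (p x * (psi x * lazy_step phi x)) =
  \int[mu]_x (p x * (lazy_step psi x * phi x)).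
Proof.
move=> mphi phiM mpsi psiN.
have bphi := bmeas_ge0 mphi phiM; have bpsi := bmeas_ge0 mpsi psiN.
have E M1 M2 (f g : T -> R) :
  measurable_fun setT f -> (forall x, 0 <= f x <= M1) ->
  measurable_fun setT g -> (forall x, 0 <= g x <= M2) ->
  \int[mu]_x (p x * (g x * lazy_step f x)) =
  \int[mu]_x (p x * (g x * f x)) +
  2^-1 * - (pair_integral (fun z => (g z.2 - g z.1) * (f z.2 - f z.1)) / 2).
  move=> mf fM mg gM; have bf := bmeas_ge0 mf fM; have bg := bmeas_ge0 mg gM.
  have bfl := bmeas_flow mf fM.
  rewrite -mulNr -(flow_form mf fM bg) -(weightedZ ip); last exact: bmeasM.
  rewrite -(weightedD ip); [|exact: bmeasM|by apply: bmeasZ; exact: bmeasM].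
  by apply: eq_Rintegral => x _; rewrite /lazy_step; congr (_ * _); ring.
rewrite (E M N)//; under [in RHS]eq_Rintegral do rewrite [_ _ * phi _]mulrC.
rewrite (E N M)//; congr (_ + _ * - (_ / _)).
  by apply: eq_Rintegral => x _; rewrite [_ _ * phi _]mulrC.
by apply: eq_Rintegral => z _; rewrite [(psi _ - _) * _]mulrC.
Qed.

(* Laziness makes the cross term of the square win over its quadratic term. *)
Lemma deviation_lazy_step M (phi : T -> R) : measurable_fun setT phi ->
  (forall x, 0 <= phi x <= M) ->
  deviation (lazy_step phi) <= deviation phi - dirichlet phi / 4.
Proof.
move=> mphi phiM; have bphi := bmeas_ge0 mphi phiM.
have bfl := bmeas_flow mphi phiM.
have bp1 : bmeas (fun x => phi x - 1) by apply: bmeasB => //; exact: bmeas_cst.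
pose G x := \int[mu]_y (k (x, y) * (phi y - phi x) ^+ 2).
have b1 : bmeas (fun z : T * T => phi z.1).
  exact: (bmeas_comp bphi (@measurable_fst _ _ T T)).
have b2 : bmeas (fun z : T * T => phi z.2).
  exact: (bmeas_comp bphi (@measurable_snd _ _ T T)).
have bS : bmeas (fun z : T * T => (phi z.1 - phi z.2) ^+ 2).
  by apply: bmeasX; exact: bmeasB.
have flG x : flow phi x ^+ 2 <= G x.
  by apply: (weighted_jensen (ik x)) => //; exact: bshift.
have bG : bmeas G.
  have [_ [N SN]] := bS.
  apply: (@bmeas_kernel_integral (fun z => (phi z.2 - phi z.1) ^+ 2) N).
    by case: (bmeasX 2 (bmeasB b2 b1)).
  move=> z; rewrite sqr_ge0/=; have := SN z.
  by rewrite -[phi z.1 - _]opprB sqrrN ger0_norm// sqr_ge0.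
have FG : \int[mu]_x (p x * flow phi x ^+ 2) <= dirichlet phi.
  apply: (@le_trans _ _ (\int[mu]_x (p x * G x))).
    by apply: (le_weighted ip) => //; exact: bmeasX.
  rewrite /dirichlet pair_integral_fubini// le_eqVlt.
  apply/orP; left; apply/eqP.
  apply: eq_Rintegral => x _; congr (_ * _).
  by apply: eq_Rintegral => y _ /=; congr (_ * _); ring.
have cross : \int[mu]_x (p x * ((phi x - 1) * flow phi x)) =
    - dirichlet phi / 2.
  rewrite (flow_form mphi phiM bp1) /dirichlet; congr (- _ / _).
  by apply: eq_Rintegral => z _; congr (_ * _); ring.
have : deviation (lazy_step phi) = deviation phi +
    \int[mu]_x (p x * ((phi x - 1) * flow phi x)) +
    4^-1 * \int[mu]_x (p x * flow phi x ^+ 2).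
  rewrite -(weightedZ ip); last exact: bmeasX.
  rewrite -(weightedD ip); [|exact: bmeasX|exact: bmeasM].
  rewrite -(weightedD ip); last first.
  - by apply: bmeasZ; exact: bmeasX.
  - by apply: bmeasD; [exact: bmeasX|exact: bmeasM].
  by apply: eq_Rintegral => x _; rewrite /lazy_step; congr (_ * _); field.
(* The cross term contributes minus one half of the Dirichlet form, the square of the flow at most
   one quarter. *)
rewrite cross; lra.
Qed.

Let bmeas_fst (f : T -> R) : bmeas f -> bmeas (fun z : T * T => f z.1).
Proof. by move=> bf; exact: (bmeas_comp bf (@measurable_fst _ _ T T)). Qed.

Let bmeas_snd (f : T -> R) : bmeas f -> bmeas (fun z : T * T => f z.2).
Proof. by move=> bf; exact: (bmeas_comp bf (@measurable_snd _ _ T T)). Qed.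

(** The mean, here 1, is the constant closest to [phi] in mean square. *)
Lemma deviation_le_dist (phi : T -> R) c : bmeas phi ->
  \int[mu]_x (p x * phi x) = 1 ->
  deviation phi <= \int[mu]_x (p x * (phi x - c) ^+ 2).
Proof.
move=> bphi phi1.
have b1 := bmeasB bphi (bmeas_cst _ 1).
have p1R : \int[mu]_x (p x * 1) = 1.
  by under eq_Rintegral do rewrite mulr1; rewrite /Rintegral p1.
have -> : \int[mu]_x (p x * (phi x - c) ^+ 2) = deviation phi +
    2 * (1 - c) * \int[mu]_x (p x * (phi x - 1)) +
    (1 - c) ^+ 2 * \int[mu]_x (p x * 1).
  rewrite -!(weightedZ ip)//; last exact: bmeas_cst.
  rewrite -(weightedD ip); [|exact: bmeasX|exact: bmeasZ].
  rewrite -(weightedD ip); last first.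
  - by apply: bmeasZ; exact: bmeas_cst.
  - by apply: bmeasD; [exact: bmeasX|exact: bmeasZ].
  by apply: eq_Rintegral => x _; congr (_ * _); ring.
rewrite (weightedB ip bphi (bmeas_cst _ 1)) phi1 p1R subrr mulr0 addr0 mulr1.
by rewrite lerDl sqr_ge0.
Qed.

(* On the core, the transition density dominates a multiple of p, so that the
   distance of phi to its mean over the core is controlled by Jensen's
   inequality. Outside the core, phi x is compared with phi y for moves (x, y)
   in down; such moves are frequent from x, but by reversibility they carry
   little mass into y, whence the condition 4 * delta <= q0. *)
Section poincare.
Variables (core : set T) (down : set (T * T)) (c0 q0 delta : R).
Hypotheses (mcore : measurable core) (mdown : measurable down).
Hypotheses (c00 : 0 < c0) (q00 : 0 < q0) (delta_q0 : 4 * delta <= q0).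
Hypothesis core_gt0 : 0 < \int[mu]_x (p x * \1_core x).
Hypothesis core_minor : forall x y, core x -> core y -> c0 * p y <= k (x, y).
Hypothesis down_often : forall x, ~ core x ->
  q0 <= \int[mu]_y (k (x, y) * \1_down (x, y)).
Hypothesis up_rare : forall x, \int[mu]_y (k (x, y) * \1_down (y, x)) <= delta.

Let mass := \int[mu]_x (p x * \1_core x).

Lemma poincare M (phi : T -> R) : measurable_fun setT phi ->
  (forall x, 0 <= phi x <= M) -> \int[mu]_x (p x * phi x) = 1 ->
  deviation phi <= (4 / q0 + 2 / (mass * c0)) * dirichlet phi.
Proof.
move=> mphi phiM phi1; have bphi := bmeas_ge0 mphi phiM.
have b1 := bmeas_indic R mcore.
have bdown := bmeas_indic R mdown.
have bdown' : bmeas (fun z : T * T => \1_down (z.2, z.1) : R) :=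
  bmeas_swap bdown.
pose c := mass^-1 * \int[mu]_x (p x * (\1_core x * phi x)).
apply: (le_trans (deviation_le_dist c bphi phi1)).
pose f x := phi x - c.
have bf : bmeas f by apply: bmeasB => //; exact: bmeas_cst.
pose G x := \int[mu]_y (k (x, y) * (phi x - phi y) ^+ 2).
have bS : bmeas (fun z : T * T => (phi z.1 - phi z.2) ^+ 2).
  by apply: bmeasX; apply: bmeasB; [exact: bmeas_fst|exact: bmeas_snd].
have bSx x : bmeas (fun y => (phi x - phi y) ^+ 2).
  exact: (bmeas_comp bS (measurable_pair1 x)).
have bG : bmeas G.
  have [mS [N SN]] := bS.
  apply: (@bmeas_kernel_integral (fun z => (phi z.1 - phi z.2) ^+ 2) N) => //.
  by move=> z; have := SN z; rewrite sqr_ge0/= ger0_norm// sqr_ge0.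
have G0 x : 0 <= G x by apply: Rintegral_ge0 => y _; rewrite mulr_ge0// sqr_ge0.
have dirE : dirichlet phi = \int[mu]_x (p x * G x).
  by rewrite /dirichlet pair_integral_fubini.
have C10 : 0 < (mass * c0)^-1 by rewrite invr_gt0 mulr_gt0.
have in_core x : core x -> f x ^+ 2 <= (mass * c0)^-1 * G x.
  (* [v] is the density of the target conditioned on the core, and c is the mean of [phi] under it;
     [core_minor] bounds [v y] by [k (x, y) / (mass * c0)]. *)
  move=> cx; pose v y := mass^-1 * (p y * \1_core y).
  have iv : mu.-integrable setT (EFin \o v).
    rewrite (_ : v = (fun y => p y * (mass^-1 * \1_core y))).
      by apply: (weighted_integrable ip); exact: bmeasZ.
    by apply/funext => y; rewrite /v mulrCA.
  have v0 y : 0 <= v y.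
    by rewrite mulr_ge0 ?invr_ge0 ?(ltW core_gt0)// mulr_ge0// indicE.
  have vE (g : T -> R) : bmeas g -> \int[mu]_y (v y * g y) =
      mass^-1 * \int[mu]_y (p y * (\1_core y * g y)).
    move=> bg; rewrite -(weightedZ ip); last exact: bmeasM.
    by apply: eq_Rintegral => y _; rewrite /v; ring.
  have v1 : \int[mu]_y (v y * 1) = 1.
    rewrite vE; last exact: bmeas_cst.
    under eq_Rintegral do rewrite mulr1.
    by rewrite mulVf// gt_eqF.
  have fE : f x = \int[mu]_y (v y * (phi x - phi y)).
    rewrite (weightedB iv (bmeas_cst _ _) bphi) (vE _ bphi) -/c /f.
    under eq_Rintegral do rewrite mulrC -[v _]mulr1.
    rewrite RintegralZl// ?v1 ?mulr1//.
    exact: (weighted_integrable iv (bmeas_cst _ 1)).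
  rewrite fE; apply: (le_trans (weighted_jensen iv v0 _ _)).
  - by apply: bmeasB => //; exact: bmeas_cst.
  - by rewrite -[leRHS]v1 le_eqVlt; apply/orP; left; apply/eqP;
      apply: eq_Rintegral => y _; rewrite mulr1.
  rewrite -RintegralZl//; last exact: (weighted_integrable (ik x) (bSx x)).
  apply: le_Rintegral => //.
  - exact: (weighted_integrable iv (bSx x)).
  - rewrite (_ : _ \o _ = EFin \o (fun y => k (x, y) *
        ((mass * c0)^-1 * (phi x - phi y) ^+ 2))).
      by apply: (weighted_integrable (ik x)); exact: bmeasZ.
    by apply/funext => y /=; congr (_%:E); ring.
  move=> y _; rewrite mulrA ler_wpM2r ?sqr_ge0// /v invfM -mulrA.
  rewrite ler_wpM2l ?invr_ge0 ?(ltW core_gt0)//.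
  rewrite ler_pdivlMl// indicE; have [/set_mem cy|_] := boolP (y \in core).
    by rewrite mulr1 core_minor.
  by rewrite !mulr0.
have coreF : \int[mu]_x (p x * (\1_core x * f x ^+ 2)) <=
    (mass * c0)^-1 * dirichlet phi.
  rewrite dirE -(weightedZ ip)//; apply: (le_weighted ip) => //.
  - by apply: bmeasM => //; exact: bmeasX.
  - exact: bmeasZ.
  move=> x; rewrite indicE; have [/set_mem cx|_] := boolP (x \in core).
    by rewrite mul1r in_core.
  by rewrite mul0r mulr_ge0// ltW.
pose H x := \int[mu]_y (k (x, y) * (\1_down (x, y) * f y ^+ 2)).
have bFF : bmeas (fun z : T * T => \1_down z * f z.2 ^+ 2).
  by apply: bmeasM => //; apply: bmeasX; exact: bmeas_snd.
have bH : bmeas H.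
  have [mF [N FN]] := bFF.
  apply: (@bmeas_kernel_integral (fun z => \1_down z * f z.2 ^+ 2) N) => //.
  have F0 z : 0 <= \1_down z * f z.2 ^+ 2 by rewrite mulr_ge0 ?sqr_ge0// indicE.
  by move=> z; have := FN z; rewrite ger0_norm// F0.
have H0 x : 0 <= H x.
  apply: Rintegral_ge0 => y _; apply: mulr_ge0 => //.
  by apply: mulr_ge0; rewrite ?sqr_ge0// indicE.
have HE : \int[mu]_x (p x * H x) <= delta * \int[mu]_x (p x * f x ^+ 2).
  have -> : \int[mu]_x (p x * H x) =
      pair_integral (fun z => \1_down z * f z.2 ^+ 2).
    by rewrite pair_integral_fubini.
  (* After the swap, the square is taken at the outer variable and the inner integral is the
     probability of an upward move, which [up_rare] bounds. *)
  rewrite -pair_integral_swap// pair_integral_fubini/=;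
    last exact: (bmeas_swap bFF).
  rewrite -(weightedZ ip); last exact: bmeasX.
  have bd : bmeas (fun x => \int[mu]_y (k (x, y) * \1_down (y, x))).
    apply: (@bmeas_kernel_integral (fun z => \1_down (z.2, z.1)) 1).
      by case: bdown'.
    by move=> z; rewrite indicE; case: (_ \in _); rewrite /= ?lexx ?ler01.
  have E x : \int[mu]_y (k (x, y) * (\1_down (y, x) * f x ^+ 2)) =
      f x ^+ 2 * \int[mu]_y (k (x, y) * \1_down (y, x)).
    rewrite -(weightedZ (ik x)); last first.
      exact: (bmeas_comp bdown' (measurable_pair1 x)).
    by apply: eq_Rintegral => y _; rewrite [_ * f x ^+ 2]mulrC.
  under eq_Rintegral do rewrite E.
  apply: (le_weighted ip) => //.
  - by apply: bmeasM => //; exact: bmeasX.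
  - by apply: bmeasZ; exact: bmeasX.
  by move=> x; rewrite mulrC ler_wpM2r// sqr_ge0.
have outside x : ~ core x -> q0 * f x ^+ 2 <= 2 * G x + 2 * H x.
  move=> ncx.
  have bdx : bmeas (fun y => \1_down (x, y) : R).
    exact: (bmeas_comp bdown (measurable_pair1 x)).
  have bFx : bmeas (fun y => \1_down (x, y) * f y ^+ 2 : R).
    by apply: bmeasM => //; exact: bmeasX.
  apply: (@le_trans _ _ (\int[mu]_y (k (x, y) * (f x ^+ 2 * \1_down (x, y))))).
    rewrite (weightedZ (ik x))// [leRHS]mulrC ler_wpM2r ?sqr_ge0//.
    exact: down_often.
  rewrite -!(weightedZ (ik x))// -(weightedD (ik x)); [|exact: bmeasZ..].
  apply: (le_weighted (ik x)) => //; first exact: bmeasZ.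
    by apply: bmeasD; exact: bmeasZ.
  move=> y; rewrite indicE.
  case: (_ \in _); rewrite /= ?mulr1 ?mul1r ?mulr0 ?mul0r.
    (* This square is the defect in f(x)^2 <= 2 (f(x) - f(y))^2 + 2 f(y)^2. *)
    rewrite -subr_ge0 (_ : _ - _ = (f x - 2 * f y) ^+ 2) ?sqr_ge0//.
    by rewrite /f; ring.
  by rewrite mulr0 addr0 mulr_ge0// sqr_ge0.
pose A := \int[mu]_x (p x * ((1 - \1_core x) * f x ^+ 2)).
pose B := \int[mu]_x (p x * (\1_core x * f x ^+ 2)).
have bf2 := bmeasX 2 bf.
have b1f : bmeas (fun x => \1_core x * f x ^+ 2) by exact: bmeasM.
have b2f : bmeas (fun x => (1 - \1_core x) * f x ^+ 2).
  by apply: bmeasM => //; apply: bmeasB => //; exact: bmeas_cst.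
have AB : \int[mu]_x (p x * f x ^+ 2) = A + B.
  rewrite /A /B -(weightedD ip)//.
  by apply: eq_Rintegral => x _; congr (_ * _); ring.
have AE : q0 * A <= 2 * dirichlet phi + 2 * (delta * (A + B)).
  apply: (@le_trans _ _ (2 * dirichlet phi + 2 * \int[mu]_x (p x * H x))).
    rewrite dirE -!(weightedZ ip)// -(weightedD ip); [|exact: bmeasZ..].
    apply: (le_weighted ip) => //; first exact: bmeasZ.
      by apply: bmeasD; exact: bmeasZ.
    move=> x; rewrite indicE; have [_|/negP cx] := boolP (x \in core).
      by rewrite subrr mul0r mulr0 addr_ge0// mulr_ge0.
    by rewrite subr0 mul1r; apply: outside => /mem_set.
  by rewrite lerD2l -AB ler_wpM2l.
have A0 : 0 <= A.
  apply: Rintegral_ge0 => x _; apply: mulr_ge0 => //.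
  by apply: mulr_ge0; rewrite ?sqr_ge0// subr_ge0 indicE; case: (_ \in _).
have B0 : 0 <= B.
  apply: Rintegral_ge0 => x _; apply: mulr_ge0 => //.
  by apply: mulr_ge0; rewrite ?sqr_ge0// indicE.
(* The term 2 delta (A + B) in [AE] is thus at most half of q0 (A + B); its part in A is absorbed on
   the left, leaving A <= (4 / q0) dirichlet + B. *)
have dAB : 4 * delta * (A + B) <= q0 * (A + B) by rewrite ler_wpM2r// addr_ge0.
rewrite -/f AB; move: coreF; rewrite -/B => coreF.
have -> : (4 / q0 + 2 / (mass * c0)) * dirichlet phi =
  q0^-1 * (4 * dirichlet phi) + 2 * ((mass * c0)^-1 * dirichlet phi) by ring.
suff : A <= q0^-1 * (4 * dirichlet phi) + B by move: coreF; lra.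
have -> : B = q0^-1 * (q0 * B) by rewrite mulKf// gt_eqF.
rewrite -mulrDr ler_pdivlMl//; lra.
Qed.

End poincare.

(** * Geometric convergence from a bounded relative density *)

Section convergence.
Variables (G M : R) (h : T -> R).
Hypotheses (G1 : 1 <= G) (mh : measurable_fun setT h).
Hypotheses (hM : forall x, 0 <= h x <= M) (h1 : \int[mu]_x (p x * h x) = 1).
Hypothesis spectral_gap : forall phi : T -> R, measurable_fun setT phi ->
  (forall x, 0 <= phi x <= M) -> \int[mu]_x (p x * phi x) = 1 ->
  deviation phi <= G * dirichlet phi.

Lemma iter_lazy_step N (phi : T -> R) n : measurable_fun setT phi ->
  (forall x, 0 <= phi x <= N) ->
  measurable_fun setT (iter n lazy_step phi) /\
  forall x, 0 <= iter n lazy_step phi x <= N.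
Proof.
move=> mphi phiN; elim: n => [//|n [IH1 IH2]] /=; split.
  exact: (measurable_lazy_step IH1 IH2).
exact: lazy_step_bounds.
Qed.

(** Duality: started from the density p h, the chain has after n steps the density p times the n-th
    iterate of [h]. *)
Lemma iter_lazy_step_selfadjoint N (phi : T -> R) n : measurable_fun setT phi ->
  (forall x, 0 <= phi x <= N) ->
  \int[mu]_x (p x * (h x * iter n lazy_step phi x)) =
  \int[mu]_x (p x * (iter n lazy_step h x * phi x)).
Proof.
elim: n phi => [//|n IH] phi mphi phiN.
have [mn nM] := iter_lazy_step n mh hM.
rewrite iterSr IH; last 2 first.
- exact: measurable_lazy_step mphi phiN.
- exact: lazy_step_bounds.
by rewrite (lazy_step_selfadjoint mphi phiN mn nM).
Qed.

Lemma lazy_step1 : lazy_step (fun=> 1) = fun=> 1.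
Proof.
apply/funext => x; rewrite /lazy_step /flow.
under eq_Rintegral do rewrite subrr mulr0.
by rewrite Rintegral_cst// !mul0r addr0.
Qed.

(** Duality with the constant 1, a fixed point of [lazy_step]. *)
Lemma iter_lazy_step_mass n : \int[mu]_x (p x * iter n lazy_step h x) = 1.
Proof.
have -> : \int[mu]_x (p x * iter n lazy_step h x) =
    \int[mu]_x (p x * (iter n lazy_step h x * 1)).
  by apply: eq_Rintegral => x _; rewrite mulr1.
rewrite -(@iter_lazy_step_selfadjoint 1 (fun=> 1)); last 2 first.
- exact: measurable_cst.
- by move=> x; rewrite ler01 lexx.
rewrite -[RHS]h1; apply: eq_Rintegral => x _; congr (_ * _).
by rewrite (_ : iter n _ _ = fun=> 1) ?mulr1//; elim: n => //= n ->;
  exact: lazy_step1.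
Qed.

Lemma deviation_iter n : deviation (iter n lazy_step h) <=
  (1 - (4 * G)^-1) ^+ n * deviation h.
Proof.
have G0 : 0 < G by rewrite (lt_le_trans _ G1).
have rho0 : 0 <= 1 - (4 * G)^-1.
  rewrite subr_ge0 invf_le1 ?mulr_gt0// (le_trans G1)//.
  by rewrite ler_peMl ?(ltW G0)// ler1n.
elim: n => [|n IH]; first by rewrite expr0 mul1r.
have [mn nM] := iter_lazy_step n mh hM.
rewrite iterS exprS -mulrA (le_trans (deviation_lazy_step mn nM))//.
have := spectral_gap mn nM (iter_lazy_step_mass n).
set a := deviation _; set b := dirichlet _ => ab.
apply: (@le_trans _ _ ((1 - (4 * G)^-1) * a)); last by rewrite ler_wpM2l.
rewrite mulrBl mul1r lerB// invfM -mulrA mulrC ler_wpM2r//.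
by rewrite ler_pdivrMl.
Qed.

(** Jensen's inequality bounds total variation by chi-square; initially the latter is at most the
    integral of p h^2, hence at most M^2. *)
Lemma tv_iter n : (\int[mu]_x (p x * `|iter n lazy_step h x - 1|)) ^+ 2 <=
  (1 - (4 * G)^-1) ^+ n * M ^+ 2.
Proof.
have [mn nM] := iter_lazy_step n mh hM.
have bn := bmeas_ge0 mn nM; have b := bmeasB bn (bmeas_cst _ 1).
have bh := bmeas_ge0 mh hM.
have G0 : 0 < G by rewrite (lt_le_trans _ G1).
have rho0 : 0 <= 1 - (4 * G)^-1.
  rewrite subr_ge0 invf_le1 ?mulr_gt0// (le_trans G1)//.
  by rewrite ler_peMl ?(ltW G0)// ler1n.
apply: (le_trans (weighted_jensen ip p0 (bmeas_norm b) _)).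
  by rewrite /Rintegral p1.
under eq_Rintegral do rewrite real_normK ?num_real//.
apply: (le_trans (deviation_iter n)); rewrite ler_wpM2l ?exprn_ge0//.
apply: (le_trans (deviation_le_dist 0 bh h1)).
have -> : M ^+ 2 = \int[mu]_x (p x * M ^+ 2).
  by rewrite RintegralZr// /Rintegral p1 mul1r.
apply: (le_weighted ip) => //.
- by apply: bmeasX; apply: bmeasB => //; exact: bmeas_cst.
- exact: bmeas_cst.
move=> x; have /andP[hx0 hxM] := hM x.
by rewrite subr0 lerXn2r// nnegrE// (le_trans hx0).
Qed.

End convergence.

End reversible_chain.

(** * Quadratic forms and extreme eigenvalues *)

Section quadratic_forms.
Variables (R : realType) (d : nat).
Implicit Types (A : 'M[R]_d) (u v : 'cV[R]_d).

Definition bform A u v : R := (u^T *m A *m v) 0 0.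

Definition nsq v : R := \sum_i v i 0 ^+ 2.

Lemma qformE A v : qform A v = bform A v v. Proof. by []. Qed.

Lemma bformDl A u1 u2 v : bform A (u1 + u2) v = bform A u1 v + bform A u2 v.
Proof. by rewrite /bform linearD/= !mulmxDl mxE. Qed.

Lemma bformDr A u v1 v2 : bform A u (v1 + v2) = bform A u v1 + bform A u v2.
Proof. by rewrite /bform mulmxDr mxE. Qed.

Lemma bformZl A a u v : bform A (a *: u) v = a * bform A u v.
Proof. by rewrite /bform linearZ/= -!scalemxAl mxE. Qed.

Lemma bformZr A a u v : bform A u (a *: v) = a * bform A u v.
Proof. by rewrite /bform -scalemxAr mxE. Qed.

Lemma bformNl A u v : bform A (- u) v = - bform A u v.
Proof. by rewrite -scaleN1r bformZl mulN1r. Qed.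

Lemma bformC A u v : A^T = A -> bform A u v = bform A v u.
Proof.
move=> sA; rewrite /bform.
rewrite -[in LHS](trmxK (u^T *m A *m v)) [in LHS]mxE !trmx_mul trmxK sA.
by rewrite mulmxA.
Qed.

Lemma qformD A u v : A^T = A ->
  qform A (u + v) = qform A u + 2 * bform A u v + qform A v.
Proof.
by move=> sA; rewrite !qformE bformDl !bformDr (bformC v u sA); ring.
Qed.

Lemma qformZ A a v : qform A (a *: v) = a ^+ 2 * qform A v.
Proof. by rewrite !qformE bformZl bformZr mulrA. Qed.

Lemma bform1 u v : bform 1%:M u v = \sum_i u i 0 * v i 0.
Proof. by rewrite /bform mulmx1 mxE; apply: eq_bigr => i _; rewrite mxE. Qed.

Lemma qform1 v : qform 1%:M v = nsq v.
Proof. by rewrite qformE bform1; apply: eq_bigr => i _. Qed.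

Lemma qform_scalar a v : qform a%:M v = a * nsq v.
Proof.
by rewrite -qform1 /qform -[a%:M]scalemx1 -scalemxAr -scalemxAl mxE.
Qed.

Lemma qform_shift A a v : qform (A - a%:M) v = qform A v - a * nsq v.
Proof.
by rewrite -qform_scalar /qform mulmxBr mulmxBl !mxE.
Qed.

Lemma nsq_ge0 v : 0 <= nsq v.
Proof. by apply: sumr_ge0 => i _; exact: sqr_ge0. Qed.

Lemma nsq_eq0 v : (nsq v == 0) = (v == 0).
Proof.
apply/idP/eqP => [|->]; last first.
  by rewrite /nsq big1// => i _; rewrite mxE expr0n.
rewrite psumr_eq0; last by move=> i _; exact: sqr_ge0.
move=> /allP v0; apply/matrixP => i j; rewrite ord1 mxE; apply/eqP.
by rewrite -sqrf_eq0; apply: v0; rewrite mem_index_enum.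
Qed.

Lemma nsq_gt0 v : (0 < nsq v) = (v != 0).
Proof. by rewrite lt_neqAle nsq_ge0 andbT eq_sym nsq_eq0. Qed.

Lemma enorm_sqr v : enorm v ^+ 2 = nsq v.
Proof. by rewrite sqr_sqrtr// nsq_ge0. Qed.

Lemma nsqZ a v : nsq (a *: v) = a ^+ 2 * nsq v.
Proof. by rewrite -!qform1 qformZ. Qed.

Lemma nsqN v : nsq (- v) = nsq v.
Proof. by rewrite -scaleN1r nsqZ sqrrN expr1n mul1r. Qed.

Lemma bform_cauchy_schwarz A u v : A^T = A -> (forall w, 0 <= qform A w) ->
  bform A u v ^+ 2 <= qform A u * qform A v.
Proof.
move=> sA psd; set a := qform A u; set b := bform A u v; set c := qform A v.
have H s t : 0 <= s ^+ 2 * a + 2 * (s * t * b) + t ^+ 2 * c.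
  have := psd (s *: u + t *: v).
  by rewrite qformD// !qformZ bformZl bformZr [s * (t * _)]mulrA.
have [c0|c0] := eqVneq c 0.
  rewrite c0 mulr0; have [->|b0] := eqVneq b 0; first by rewrite expr0n.
  (* With c = 0 the form is affine in t; this t gives it the value -1. *)
  have := H 1 (- (a + 1) / (2 * b)); rewrite c0 mulr0 addr0.
  have -> : 2 * (1 * (- (a + 1) / (2 * b)) * b) = - (a + 1) by field.
  lra.
have c1 : 0 < c by rewrite lt_neqAle eq_sym c0; exact: psd.
have := H c (- b).
have -> : c ^+ 2 * a + 2 * (c * - b * b) + (- b) ^+ 2 * c =
  c * (a * c - b ^+ 2) by ring.
by rewrite pmulr_rge0// subr_ge0.
Qed.

Lemma qform_bound A : exists2 C, 0 < C & forall v, `|qform A v| <= C * nsq v.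
Proof.
exists (1 + \sum_i \sum_j `|A j i|) => [|v].
  rewrite ltr_wpDr// sumr_ge0// => i _; exact: sumr_ge0.
have vi i : `|v i 0| <= Num.sqrt (nsq v).
  rewrite -sqrtr_sqr ler_wsqrtr// /nsq (bigD1 i)//= lerDl.
  by apply: sumr_ge0 => j _; exact: sqr_ge0.
rewrite mulrDl mul1r; apply: (@le_trans _ _ ((\sum_i \sum_j `|A j i|) * nsq v)).
  rewrite /qform mxE mulr_suml; apply: (le_trans (ler_norm_sum _ _ _)).
  apply: ler_sum => i _; rewrite mxE big_distrl/= mulr_suml.
  apply: (le_trans (ler_norm_sum _ _ _)); apply: ler_sum => j _.
  rewrite mxE !normrM -[nsq v]sqr_sqrtr ?nsq_ge0// expr2.
  by rewrite mulrAC mulrC; apply: ler_wpM2l => //; exact: ler_pM.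
by rewrite lerDr nsq_ge0.
Qed.

(** Cauchy-Schwarz for the form of [A], at v and A^-1 v, gives |v|^4 <= q_A(v) q_(A^-1)(v), and the
    last factor is at most C |v|^2. *)
Lemma psd_unit_coercive A : A^T = A -> (forall v, 0 <= qform A v) ->
  A \in unitmx -> exists2 c, 0 < c & forall v, c * nsq v <= qform A v.
Proof.
move=> sA psd uA; have [C C0 HC] := qform_bound (invmx A).
exists C^-1 => [|v]; first by rewrite invr_gt0.
rewrite ler_pdivrMl//.
have [->|v0] := eqVneq v 0.
  by rewrite (eqP (_ : nsq 0 == 0)) ?nsq_eq0// mulr_ge0// ltW.
have n0 : 0 < nsq v by rewrite nsq_gt0.
have := bform_cauchy_schwarz v (invmx A *m v) sA psd.
have -> : bform A v (invmx A *m v) = nsq v.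
  by rewrite /bform mulmxA mulmxK// -qform1 /qform mulmx1.
have -> : qform A (invmx A *m v) = qform (invmx A) v.
  rewrite /qform trmx_mul trmx_inv sA -!mulmxA.
  by rewrite [A *m _]mulmxA mulmxV// mul1mx.
move=> H; rewrite -(ler_pM2r n0) -expr2 (le_trans H)// mulrC mulrAC.
by rewrite ler_wpM2r// (le_trans (ler_norm _)).
Qed.

(* If the infimum m of the Rayleigh quotient were not an eigenvalue, A - m would
   be coercive, and m could be increased. *)
Lemma min_eigenvalue A : (0 < d)%N -> A^T = A ->
  exists2 m, eigenvalue A m & forall v, m * nsq v <= qform A v.
Proof.
move=> d0 sA; have [C C0 HC] := qform_bound A.
pose E := [set a : R | forall v, a * nsq v <= qform A v].
pose e : 'cV[R]_d := const_mx 1.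
have e0 : 0 < nsq e.
  rewrite nsq_gt0; apply/eqP => /matrixP/(_ (Ordinal d0) 0)/eqP.
  by rewrite !mxE oner_eq0.
have supE : has_sup E.
  split.
    exists (- C) => v; have := HC v; rewrite ler_norml => /andP[+ _].
    by rewrite mulNr.
  by exists (qform A e / nsq e) => a /(_ e); rewrite ler_pdivlMr.
pose m := sup E.
have Hm v : m * nsq v <= qform A v.
  have [->|v0] := eqVneq v 0.
    by rewrite (eqP (_ : nsq 0 == 0)) ?nsq_eq0// mulr0 /qform mulmx0 mxE.
  have n0 : 0 < nsq v by rewrite nsq_gt0.
  rewrite -ler_pdivlMr//; apply: ge_sup; first by case: supE.
  by move=> a /(_ v); rewrite ler_pdivlMr.
exists m => //; rewrite /eigenvalue /eigenspace kermx_eq0 row_free_unit.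
apply/negP => um.
have sAm : (A - m%:M)^T = A - m%:M by rewrite linearB/= sA tr_scalar_mx.
have psd v : 0 <= qform (A - m%:M) v by rewrite qform_shift subr_ge0.
have [c c0 Hc] := psd_unit_coercive sAm psd um.
have : E (m + c).
  by move=> v; have := Hc v; rewrite qform_shift mulrDl; lra.
move=> /(ub_le_sup supE.2); rewrite -/m; lra.
Qed.

Lemma eigenvalue_rayleigh A a : eigenvalue A a ->
  exists2 v, v != 0 & qform A v = a * nsq v.
Proof.
move=> /eigenvalueP[v vA v0]; exists v^T.
  by apply: contraNneq v0 => v0; rewrite -(trmxK v) v0 trmx0.
by rewrite /qform trmxK vA -scalemxAl mxE -qform1 /qform mulmx1 trmxK.
Qed.

Lemma eigenvalueN A a : eigenvalue (- A) a -> eigenvalue A (- a).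
Proof.
move=> /eigenvalueP[v vA v0]; apply/eigenvalueP; exists v => //.
by rewrite scaleNr -vA mulmxN opprK.
Qed.

Lemma gamma_minP A : (0 < d)%N -> A^T = A ->
  eigenvalue A (gamma_min A) /\ forall v, gamma_min A * nsq v <= qform A v.
Proof.
move=> d0 sA; have [m em Hm] := min_eigenvalue d0 sA.
suff -> : gamma_min A = m by [].
have lb a : eigenvalue A a -> m <= a.
  move=> /eigenvalue_rayleigh[v v0 va].
  by rewrite -(@ler_pM2r _ (nsq v)) ?nsq_gt0// -va.
apply/eqP; rewrite eq_le; apply/andP; split.
  by apply: ge_inf => //; exists m => a /lb.
by apply: lb_le_inf; [exists m|move=> a /lb].
Qed.

Lemma gamma_maxP A : (0 < d)%N -> A^T = A ->
  eigenvalue A (gamma_max A) /\ forall v, qform A v <= gamma_max A * nsq v.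
Proof.
move=> d0 sA; have sNA : (- A)^T = - A by rewrite linearN/= sA.
have [m em Hm] := min_eigenvalue d0 sNA.
have HM v : qform A v <= - m * nsq v.
  have := Hm v; have -> : qform (- A) v = - qform A v.
    by rewrite /qform mulmxN mulNmx mxE.
  lra.
have em' := eigenvalueN em.
suff -> : gamma_max A = - m by [].
have ub a : eigenvalue A a -> a <= - m.
  move=> /eigenvalue_rayleigh[v v0 va].
  by rewrite -(@ler_pM2r _ (nsq v)) ?nsq_gt0// -va.
apply/eqP; rewrite eq_le; apply/andP; split.
  by apply: ge_sup; [exists (- m)|move=> a /ub].
by apply: ub_le_sup => //; exists (- m) => a /ub.
Qed.

Section posdef.
Variable A : 'M[R]_d.
Hypotheses (d0 : (0 < d)%N) (pA : posdef A).

Let sA : A^T = A. Proof. by case: pA. Qed.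

Lemma posdef_qform_ge0 v : 0 <= qform A v.
Proof.
have [->|v0] := eqVneq v 0; first by rewrite /qform mulmx0 mxE.
by apply: ltW; apply: pA.2.
Qed.

Lemma gamma_min_gt0 : 0 < gamma_min A.
Proof.
have [/eigenvalue_rayleigh[v v0 va] _] := gamma_minP d0 sA.
have := pA.2 v v0; rewrite va => H.
by rewrite -(@pmulr_lgt0 _ (nsq v)) ?nsq_gt0.
Qed.

Lemma gamma_min_le_max : gamma_min A <= gamma_max A.
Proof.
have [/eigenvalue_rayleigh[v v0 va] _] := gamma_minP d0 sA.
have [_ H] := gamma_maxP d0 sA.
by rewrite -(@ler_pM2r _ (nsq v)) ?nsq_gt0// -va.
Qed.

Lemma posdef_unit : A \in unitmx.
Proof.
rewrite -row_free_unit -kermx_eq0; apply/negPn/negP => k0.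
have /eigenvalue_rayleigh[v v0 va] : eigenvalue A 0.
  by rewrite /eigenvalue /eigenspace (_ : A - _ = A)// raddf0 subr0.
by have := pA.2 v v0; rewrite va mul0r ltxx.
Qed.

Lemma tr_invmx : (invmx A)^T = invmx A.
Proof. by rewrite trmx_inv sA. Qed.

Let invE v : qform (invmx A) v = qform A (invmx A *m v).
Proof.
rewrite /qform trmx_mul tr_invmx -!mulmxA.
by rewrite [A *m _]mulmxA mulmxV ?posdef_unit// mul1mx.
Qed.

Lemma qform_inv_ge0 v : 0 <= qform (invmx A) v.
Proof. by rewrite invE posdef_qform_ge0. Qed.

Lemma qform_inv_ge v : nsq v / gamma_max A <= qform (invmx A) v.
Proof.
have g0 : 0 < gamma_max A := lt_le_trans gamma_min_gt0 gamma_min_le_max.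
have [->|v0] := eqVneq v 0.
  by rewrite (eqP (_ : nsq 0 == 0)) ?nsq_eq0// mul0r qform_inv_ge0.
have n0 : 0 < nsq v by rewrite nsq_gt0.
have := bform_cauchy_schwarz v (invmx A *m v) sA posdef_qform_ge0.
have -> : bform A v (invmx A *m v) = nsq v.
  by rewrite /bform mulmxA mulmxK ?posdef_unit// -qform1 /qform mulmx1.
rewrite -invE => H; rewrite ler_pdivrMr// -(ler_pM2r n0) -expr2 (le_trans H)//.
rewrite mulrC -mulrA ler_wpM2l ?qform_inv_ge0//.
by have [_] := gamma_maxP d0 sA; apply.
Qed.

(** Here Cauchy-Schwarz is Euclidean: with w = A^-1 v, q^2 <= |v|^2 |w|^2, while gamma_min |w|^2 <=
    q. *)
Lemma qform_inv_le v : qform (invmx A) v <= nsq v / gamma_min A.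
Proof.
have g0 := gamma_min_gt0; set q := qform _ _.
have [->|q0] := eqVneq q 0; first by rewrite mulr_ge0 ?nsq_ge0// invr_ge0 ltW.
have q1 : 0 < q by rewrite lt_neqAle eq_sym q0; exact: qform_inv_ge0.
set w := invmx A *m v.
have H1 : gamma_min A * nsq w <= q.
  by rewrite /q invE; have [_] := gamma_minP d0 sA; apply.
have H2 : q ^+ 2 <= nsq v * nsq w.
  have := @bform_cauchy_schwarz 1%:M v w (trmx1 _ _).
  rewrite !qform1 => /(_ _)-H; apply: le_trans (H _).
    by rewrite /q /qform /bform mulmx1 /w mulmxA.
  by move=> z; rewrite qform1 nsq_ge0.
rewrite ler_pdivlMr// -(ler_pM2r q1) mulrAC -expr2.
rewrite (le_trans (ler_wpM2r (ltW g0) H2))//.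
by rewrite -mulrA ler_wpM2l ?nsq_ge0// mulrC.
Qed.

End posdef.

End quadratic_forms.

(** * Lebesgue measure and isotropic Gaussians on tuples *)

Section lebesgue_tuple_integral.
Variable R : realType.
Local Notation leb d := (lebesgue_tuple R d).

Lemma integral_lebesgue_tupleS d (f : point R d.+1 -> \bar R) :
  measurable_fun setT f -> (forall x, (0 <= f x)%E) ->
  (\int[leb d.+1]_x f x =
   \int[@lebesgue_measure R]_t \int[leb d]_x f (tuple_cons (t, x)))%E.
Proof.
move=> mf f0.
have mc := @measurable_tuple_cons R d.
transitivity (\int[(@lebesgue_measure R \x leb d)%E]_z f (tuple_cons z))%E.
  rewrite -(@ge0_integral_pushforward _ _ _ _ R _ mc
    (@lebesgue_measure R \x leb d)%E setT f)//=.
rewrite (@fubini_tonelli1 _ _ _ _ _ (@lebesgue_measure R) (leb d)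
  (fun z => f (tuple_cons z)))//.
exact: measurableT_comp.
Qed.

Lemma measurable_tnth_prod d (F : 'I_d -> R -> R) :
  (forall i, measurable_fun setT (F i)) ->
  measurable_fun setT (fun x : point R d => \prod_i F i (tnth x i)).
Proof.
move=> mF; apply: measurable_prod => i _.
exact: measurableT_comp (mF i) (measurable_tnth i).
Qed.

Lemma integral_lebesgue_tuple_prod d (F : 'I_d -> R -> R) (c : 'I_d -> R) :
  (forall i, measurable_fun setT (F i)) -> (forall i t, 0 <= F i t) ->
  (forall i, \int[@lebesgue_measure R]_t (F i t)%:E = (c i)%:E)%E ->
  (\int[leb d]_x (\prod_i F i (tnth x i))%:E = (\prod_i c i)%:E)%E.
Proof.
elim: d F c => [|d IH] F c mF F0 Fc.
  under eq_integral do rewrite big_ord0.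
  by rewrite big_ord0 /= integral_dirac// diracT mul1e.
rewrite integral_lebesgue_tupleS; last 2 first.
- by apply/measurable_EFinP; exact: measurable_tnth_prod.
- by move=> x; rewrite lee_fin prodr_ge0.
under eq_integral => t _.
  under eq_integral => x _.
    rewrite big_ord_recl/= tnth0.
    under eq_bigr do rewrite tnthS.
    rewrite EFinM; over.
  rewrite /= ge0_integralZl//=; last 3 first.
  - apply/measurable_EFinP.
    exact: (@measurable_tnth_prod _ (fun i => F (lift ord0 i))).
  - by move=> x _; rewrite lee_fin prodr_ge0.
  - by rewrite lee_fin.
  over.
- under eq_integral do rewrite /= (IH (fun i => F (lift ord0 i))
    (fun i => c (lift ord0 i)))//.
  rewrite ge0_integralZr//= ?Fc ?big_ord_recl ?EFinM//.
  - by apply/measurable_EFinP; exact: (mF ord0).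
  - by move=> t _; rewrite lee_fin.
  - rewrite lee_fin prodr_ge0// => i _; rewrite -lee_fin -Fc.
    by apply: integral_ge0 => t _; rewrite lee_fin.
Qed.

(** A cube replaces the natural ball because its indicator is a product over coordinates, which
    makes its volume explicit. *)
Lemma box_lower_bound d (v : 'cV[R]_d) (s a : R) (g : point R d -> R) :
  0 <= s -> 0 <= a -> measurable_fun setT g -> (forall x, 0 <= g x) ->
  (forall x, (forall i, `|tnth x i - v i 0| <= s) -> a <= g x) ->
  ((a * (2 * s) ^+ d)%:E <= \int[leb d]_x (g x)%:E)%E.
Proof.
move=> s0 a0 mg g0 ag.
pose F i (t : R) : R := \1_`[v i 0 - s, v i 0 + s] t.
have F0 i t : 0 <= F i t by rewrite /F indicE.
have mF i : measurable_fun setT (F i).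
  by apply: measurable_indic; exact: measurable_itv.
have Fc i : (\int[@lebesgue_measure R]_t (F i t)%:E = (2 * s)%:E)%E.
  rewrite integral_indic//= setIT lebesgue_measure_itv/= lte_fin.
  case: ltP => [_|]; first by rewrite -EFinB; congr (_%:E); ring.
  by move=> H; congr (_%:E); lra.
have := integral_lebesgue_tuple_prod (c := fun=> 2 * s) mF F0 Fc.
rewrite prodr_const card_ord => E.
rewrite EFinM -E -ge0_integralZl//; last 2 first.
- by apply/measurable_EFinP; exact: measurable_tnth_prod.
- by move=> x _; rewrite lee_fin prodr_ge0.
apply: ge0_le_integral => //.
- by move=> x _; rewrite mule_ge0 ?lee_fin ?prodr_ge0.
- apply: emeasurable_funM => //.
  by apply/measurable_EFinP; exact: measurable_tnth_prod.
- exact/measurable_EFinP.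
move=> x _; rewrite -EFinM lee_fin.
have [/forallP H|] := boolP [forall i, `|tnth x i - v i 0| <= s].
  rewrite big1 ?mulr1 ?ag// => i _; rewrite /F indicE mem_set//=.
  by have := H i; rewrite in_itv/= ler_norml; lra.
rewrite negb_forall => /existsP[i Hi].
rewrite (bigD1 i)//= {1}/F indicE memNset ?mul0r ?mulr0//=.
by move: Hi; rewrite in_itv/= ler_norml => /negP H H'; apply: H; lra.
Qed.

End lebesgue_tuple_integral.

Lemma sqrtr_pow (R : rcfType) (x : R) n : 0 <= x ->
  Num.sqrt (x ^+ n) = Num.sqrt x ^+ n.
Proof.
move=> x0; elim: n => [|n IH]; first by rewrite !expr0 sqrtr1.
by rewrite !exprS sqrtrM// IH.
Qed.

Section gauss_scalar.
Variables (R : realType) (d : nat).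
Implicit Types (m : 'cV[R]_d) (a : R).

Lemma invmx_scalar a : a != 0 -> invmx (a%:M : 'M[R]_d) = a^-1%:M.
Proof.
move=> a0; have ua : (a%:M : 'M[R]_d) \in unitmx.
  by rewrite unitmxE det_scalar unitfE expf_neq0.
rewrite -[LHS]mulmx1 -[1%:M](_ : a%:M *m a^-1%:M = _); last first.
  by rewrite -scalar_mxM mulfV.
by rewrite mulmxA mulVmx// mul1mx.
Qed.

Lemma gauss_pdf_scalar a m x : 0 < a -> gauss_pdf m a%:M x =
  expR (- (nsq (col_of x - m) / (2 * a))) / Num.sqrt ((2 * pi * a) ^+ d).
Proof.
move=> a0; rewrite /gauss_pdf invmx_scalar ?gt_eqF// det_scalar -exprMn.
congr (expR (- _) / _); rewrite qform_scalar invfM; ring.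
Qed.

Lemma gauss_pdf_gt0 a m x : 0 < a -> 0 < gauss_pdf m a%:M x.
Proof.
move=> a0; rewrite gauss_pdf_scalar// divr_gt0 ?expR_gt0// sqrtr_gt0.
by rewrite exprn_gt0// !mulr_gt0// pi_gt0.
Qed.

Lemma gauss_pdf_prod a m x : 0 < a -> gauss_pdf m a%:M x =
  \prod_i normal_pdf (m i 0) (Num.sqrt a) (tnth x i).
Proof.
move=> a0; rewrite gauss_pdf_scalar//.
have s0 : Num.sqrt a != 0 by rewrite gt_eqF// sqrtr_gt0.
under eq_bigr do rewrite normal_pdfE// /normal_peak /normal_fun.
rewrite big_split/= prodr_const card_ord sqr_sqrtr ?ltW// mulrC.
have -> : a * pi *+ 2 = 2 * pi * a by rewrite mulr2n; ring.
rewrite exprVn; congr (_^-1 * _).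
  by apply: sqrtr_pow; rewrite ltW// !mulr_gt0// pi_gt0.
rewrite -expR_sum; congr expR; rewrite /nsq mulr_suml -sumrN.
apply: eq_bigr => i _; rewrite !mxE -[a *+ 2]mulr_natl.
by rewrite mulNr.
Qed.

Lemma measurable_gauss_pdf a m : 0 < a ->
  measurable_fun setT (fun x : point R d => gauss_pdf m a%:M x).
Proof.
move=> a0; under eq_fun do rewrite gauss_pdf_prod//.
apply: (measurable_tnth_prod
  (F := fun i => normal_pdf (m i 0) (Num.sqrt a))) => i.
exact: measurable_normal_pdf.
Qed.

Lemma integral_gauss_pdf a m : 0 < a ->
  (\int[lebesgue_tuple R d]_x (gauss_pdf m a%:M x)%:E = 1)%E.
Proof.
move=> a0; under eq_integral do rewrite gauss_pdf_prod//.
rewrite (integral_lebesgue_tuple_prod (c := fun=> 1)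
  (F := fun i => normal_pdf (m i 0) (Num.sqrt a))).
- by rewrite big1.
- by move=> i; exact: measurable_normal_pdf.
- by move=> i t; exact: normal_pdf_ge0.
- by move=> i; exact: integral_normal_pdf.
Qed.

Lemma gauss_pdf_integrable a m : 0 < a ->
  (lebesgue_tuple R d).-integrable setT (EFin \o gauss_pdf m a%:M).
Proof.
move=> a0; apply: ge0_integrable.
- exact: measurable_gauss_pdf.
- by move=> x; exact: ltW (gauss_pdf_gt0 _ _ _).
- by rewrite integral_gauss_pdf// ltey.
Qed.

End gauss_scalar.

Section measurable_vectors.
Context dT (T : measurableType dT) (R : realType) (d : nat).
Variable g : T -> 'cV[R]_d.
Hypothesis mg : forall i, measurable_fun setT (fun x => g x i 0).

Lemma measurable_qform (A : 'M[R]_d) :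
  measurable_fun setT (fun x => qform A (g x)).
Proof.
under eq_fun do rewrite /qform mxE.
apply: measurable_sum => i; apply: measurable_funM => //.
under eq_fun do rewrite mxE.
apply: measurable_sum => j; apply: measurable_funM => //.
by under eq_fun do rewrite mxE; exact: mg.
Qed.

Lemma measurable_nsq : measurable_fun setT (fun x => nsq (g x)).
Proof. by under eq_fun do rewrite -qform1; exact: measurable_qform. Qed.

End measurable_vectors.

(** * The algorithm run with a single level *)

(** With one level, level moves leave the state unchanged; the rate 1/2 is therefore the laziness of
    the chain. *)
Definition one_level (R : realType) d (eta a : R) (N : nat) : stmh_params R d :=
  StmhParams 1 (fun=> 1) eta 2^-1 a%:M N 1.

Section one_level.
Variables (R : realType) (d : nat) (f : point R d -> R).
Variables (eta a : R) (N : nat).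
Hypotheses (eta0 : 0 < eta) (a0 : 0 < a).
Hypothesis mf : measurable_fun setT f.

Local Notation leb := (lebesgue_tuple R d).
Local Notation P := (one_level d eta a N).

Definition metropolis (z : point R d * point R d) : R :=
  gauss_pdf (col_of z.1) eta%:M z.2 *
  Num.min 1 (expR (- f z.2) / expR (- f z.1)).

Lemma measurable_metropolis : measurable_fun setT metropolis.
Proof.
have mfst := @measurable_fst _ _ (point R d) (point R d).
have msnd := @measurable_snd _ _ (point R d) (point R d).
have mcol i := measurable_tnth (T := measurableTypeR R) (n := d) i.
apply: measurable_funM.
  under eq_fun do rewrite gauss_pdf_scalar//.
  apply: measurable_funM => //; apply: measurableT_comp => //.
  apply: measurableT_comp => //; apply: measurable_funM => //.
  apply: measurable_nsq => i; under eq_fun do rewrite !mxE.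
  apply: measurable_funB.
    exact: (measurableT_comp (mcol i) msnd).
  exact: (measurableT_comp (mcol i) mfst).
apply: measurable_minr => //; apply: measurable_funM.
  apply: measurableT_comp => //; apply: measurableT_comp => //.
  exact: measurableT_comp mf msnd.
under eq_fun do rewrite -expRN opprK.
by apply: measurableT_comp => //; exact: measurableT_comp mf mfst.
Qed.

Lemma metropolis_ge0 z : 0 <= metropolis z.
Proof.
by rewrite mulr_ge0 ?(ltW (gauss_pdf_gt0 _ _ _)).
Qed.

Lemma metropolis_le z : metropolis z <= gauss_pdf (col_of z.1) eta%:M z.2.
Proof.
by rewrite ler_piMr ?(ltW (gauss_pdf_gt0 _ _ _))// ge_min lexx.
Qed.

Lemma metropolis_mass x : (\int[leb]_y (metropolis (x, y))%:E <= 1)%E.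
Proof.
rewrite -(integral_gauss_pdf (col_of x) eta0).
apply: ge0_le_integral => //.
- by move=> y _; rewrite lee_fin metropolis_ge0.
- apply/measurable_EFinP.
  exact: measurableT_comp measurable_metropolis (measurable_pair1 x).
- by apply/measurable_EFinP; exact: measurable_gauss_pdf.
- by move=> y _; rewrite lee_fin; exact: (metropolis_le (x, y)).
Qed.

Local Notation lazy := (lazy_step leb metropolis).

Lemma metropolis_integrable x :
  leb.-integrable setT (EFin \o (fun y => metropolis (x, y))).
Proof.
apply: ge0_integrable.
- exact: measurableT_comp measurable_metropolis (measurable_pair1 x).
- by move=> y; exact: metropolis_ge0.
- by rewrite (le_lt_trans (metropolis_mass x))// ltey.
Qed.

Section values.
Variables (M : R).

Lemma stmh_step_value Z (phi : point R d -> R)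
    (g : point R d * nat -> \bar R) x :
  measurable_fun setT phi -> (forall y, 0 <= phi y <= M) ->
  (forall y, g (y, 1%N) = (phi y)%:E) ->
  stmh_step f P 1 Z (x, 1%N) g = (lazy phi x)%:E.
Proof.
move=> mphi phiM gE; have bphi := bmeas_ge0 mphi phiM.
have level : level_move f P 1 Z (x, 1%N) g = (phi x)%:E.
  rewrite /level_move /level_try /choose /= /ret gE -!EFinM -EFinD.
  by congr (_%:E); field.
have ik := metropolis_integrable x.
have ig := gauss_pdf_integrable (col_of x) eta0.
have bsh : bmeas (fun y => phi y - phi x).
  by apply: bmeasB => //; exact: bmeas_cst.
have move : position_move f P (x, 1%N) g =
    (phi x + flow leb metropolis phi x)%:E.
  rewrite /position_move /bind /gauss /choose /ret /=.
  rewrite /flow EFinD (EFin_weighted ik bsh).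
  (* Writing [phi x] as an integral over proposals cancels the contribution of rejections and leaves
     the flow. *)
  have E : (\int[leb]_y (gauss_pdf (col_of x) eta%:M y * phi x)%:E =
      (phi x)%:E)%E.
    rewrite -(EFin_weighted ig (bmeas_cst _ _)) RintegralZr//.
      by rewrite /Rintegral integral_gauss_pdf// mul1r.
  rewrite -[X in (X + _)%E]E -integralD//; last 2 first.
  - by apply: (weighted_integrable ig); exact: bmeas_cst.
  - exact: (weighted_integrable ik).
  apply: eq_integral => y _; rewrite !gE -!EFinM -!EFinD; congr (_%:E).
  by rewrite /metropolis /gibbs /= !mulN1r; ring.
rewrite /stmh_step /choose level move -!EFinM -EFinD; congr (_%:E).
by rewrite /lazy_step /=; field.
Qed.

(** In continuation style the last step is the first to act on the test function. *)
Lemma iter_bind (S : point R d * nat -> prog R (point R d * nat)) M0 n g :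
  iter n (fun M1 => bind M1 S) M0 g = M0 (iter n (fun g z => S z g) g).
Proof. by elim: n g => [//|n IH] g; rewrite iterS {1}/bind IH -iterSr. Qed.

Lemma stmh_run_value Z (phi : point R d -> R) (g : point R d * nat -> \bar R) :
  measurable_fun setT phi -> (forall y, 0 <= phi y <= M) ->
  (forall y, g (y, 1%N) = (phi y)%:E) ->
  stmh_run f P 1 Z g =
  (\int[leb]_x (gauss_pdf 0 a%:M x * iter N lazy phi x)%:E)%E.
Proof.
move=> mphi phiM gE; rewrite /stmh_run iter_bind /bind /gauss /ret /=.
have H n y : iter n (fun g z => stmh_step f P 1 Z z g) g (y, 1%N) =
    (iter n lazy phi y)%:E.
  elim: n y => [|n IH] y; first exact: gE.
  have [mn nM] := iter_lazy_step measurable_metropolis metropolis_ge0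
    metropolis_mass n mphi phiM.
  exact: (stmh_step_value Z y mn nM IH).
by apply: eq_integral => x _; rewrite H -EFinM.
Qed.

Lemma stmh_algorithm_value (phi : point R d -> R)
    (g : point R d * nat -> \bar R) :
  measurable_fun setT phi -> (forall y, 0 <= phi y <= M) ->
  (forall y, g (y, N) = (phi y)%:E) ->
  stmh_algorithm f P g =
  (\int[leb]_x (gauss_pdf 0 a%:M x * iter N lazy phi x)%:E)%E.
Proof.
move=> mphi phiM gE; rewrite /stmh_algorithm /= /bind /ret /collect /limit.
set v := (\int[leb]_x _)%E.
have v0 : (0 <= v)%E.
  apply: integral_ge0 => x _.
  rewrite lee_fin mulr_ge0 ?(ltW (gauss_pdf_gt0 _ _ _))//.
  have [_ nM] := iter_lazy_step measurable_metropolis metropolis_ge0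
    metropolis_mass N mphi phiM.
  by have /andP[] := nM x.
(* A single run yields the sample, so the approximations of the loop are 0 for k = 0 and v from k =
   1 on; as v is nonnegative, it is their supremum. *)
pose F k := collect_upto f P 1 (fun=> 1) k 1 [::] 0
  (fun x => (let '(xs, t') := x in
    fun g' : _ -> \bar R => g' (head [tuple of nseq d 0] xs, (0 + t')%N)) g).
have F0 : F 0 = 0%E by [].
have FS k : F k.+1 = v.
  rewrite /F /= {1}/bind; apply: (stmh_run_value _ mphi phiM) => y /=.
  by case: k => [|k] /=; rewrite /ret /= ?add0n gE.
rewrite -[LHS]/(ereal_sup (range F)).
apply/eqP; rewrite eq_le; apply/andP; split.
  by apply: ge_ereal_sup => _ [[|k] _ <-]; rewrite ?F0 ?FS.
by apply: ereal_sup_ubound; exists 1%N => //; exact: FS.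
Qed.

End values.

End one_level.

(** * Poincare inequality for the Gaussian mixture *)

Section norms.
Variables (R : realType) (d : nat).
Implicit Types u v : 'cV[R]_d.

Lemma nsqB_le u v : nsq (u - v) <= 2 * (nsq u + nsq v).
Proof.
rewrite /nsq -big_split/= mulr_sumr; apply: ler_sum => i _; rewrite !mxE.
by rewrite -subr_ge0 (_ : _ - _ = (u i 0 + v i 0) ^+ 2) ?sqr_ge0//; ring.
Qed.

Lemma bform_le A u v (c a b : R) : A^T = A -> (forall w, 0 <= qform A w) ->
  (forall w, qform A w <= c * nsq w) -> 0 <= a -> 0 <= b -> 0 <= c ->
  nsq u <= a ^+ 2 -> nsq v <= b ^+ 2 -> `|bform A u v| <= c * a * b.
Proof.
move=> sA A0 Ac a0 b0 c0 ua vb.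
rewrite -(@ler_pXn2r _ 2)// ?nnegrE ?mulr_ge0//.
rewrite real_normK ?num_real// (le_trans (bform_cauchy_schwarz u v sA A0))//.
have -> : (c * a * b) ^+ 2 = (c * a ^+ 2) * (c * b ^+ 2) by ring.
apply: ler_pM => //.
- by rewrite (le_trans (Ac u))// ler_wpM2l.
- by rewrite (le_trans (Ac v))// ler_wpM2l.
Qed.

Lemma nsqD_le u v (a b : R) : 0 <= a -> 0 <= b ->
  nsq u <= a ^+ 2 -> nsq v <= b ^+ 2 -> nsq (u + v) <= (a + b) ^+ 2.
Proof.
move=> a0 b0 ua vb; rewrite -!qform1 qformD ?trmx1// !qform1.
have : `|bform 1%:M u v| <= 1 * a * b.
  apply: bform_le => //; first exact: trmx1.
  - by move=> w; rewrite qform1 nsq_ge0.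
  - by move=> w; rewrite qform1 mul1r.
rewrite ler_norml mul1r => /andP[_ H].
rewrite sqrrD -[_ *+ 2]mulr_natl; lra.
Qed.

Lemma nsq_box_le v s : 0 <= s -> (forall i, `|v i 0| <= s) ->
  nsq v <= d%:R * s ^+ 2.
Proof.
move=> s0 vs; rewrite /nsq -[d in d%:R]card_ord -sum1_card natr_sum mulr_suml.
apply: ler_sum => i _; rewrite mul1r -(real_normK (num_real _)).
by rewrite lerXn2r// nnegrE.
Qed.

End norms.

Section constants.
Variables (R : realType) (d : nat) (Sigma : 'M[R]_d) (D wmin : R).

(* With b := shrink_const and k := condition_number Sigma, a proposal from outside
   the ball of radius core_radius moves inwards by b k D, up to b D / 2, with
   probability at least 1 / escape_const, and then multiplies the density by at
   least expR (2 b^2 k^2); b is chosen such that this factor exceeds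
   4 * escape_const. *)
Definition dim_const : R := 15 * Num.sqrt (2 * pi * d%:R).

Definition shrink_const : R := 3 + d%:R * dim_const.

Definition core_radius : R :=
  15 * shrink_const * condition_number Sigma ^+ 2 * D.

Definition scaled_radius : R := D / Num.sqrt (gamma_min Sigma).

Definition escape_const : R :=
  expR 1 * (dim_const * condition_number Sigma ^+ 2) ^+ d.

(** Bounds the constant 4 / q0 + 2 / (mass * c0) of [poincare], with q0 the inverse of
    [escape_const]. *)
Definition mix_const : R := 4 * escape_const +
  2 * (expR (5 / 2) / wmin * (dim_const * shrink_const *
       condition_number Sigma ^+ 2 * scaled_radius) ^+ d).

(* Bounds the density of the initial law N(0, gamma_min Sigma / 2) with respect to
   the target. *)
Definition warmness : R :=
  expR (scaled_radius ^+ 2) * Num.sqrt ((2 * condition_number Sigma) ^+ d).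

(** The squared warmness is at most the exponential of the first two terms in the parentheses; the
    third brings the squared error down to eps^2. The maximum with 2 keeps the logarithm positive
    for large eps. *)
Definition mixing_time (eps : R) : nat :=
  (Num.truncn (4 * mix_const * (2 * scaled_radius ^+ 2 +
     2 * d%:R * condition_number Sigma + 2 * ln (Num.max 2 (1 / eps))))).+1.

End constants.

Section mixture_density.
Variables (R : realType) (d n : nat).
Variables (mu : 'I_n -> 'cV[R]_d) (Sigma : 'M[R]_d) (w : 'I_n -> R).
Hypotheses (d0 : (0 < d)%N) (pS : posdef Sigma).
Hypotheses (w0 : forall i, 0 < w i) (w1 : \sum_i w i = 1).

Local Notation leb := (lebesgue_tuple R d).
Local Notation D := (mixture_radius mu Sigma).
Local Notation gm := (gamma_min Sigma).
Local Notation gM := (gamma_max Sigma).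
Local Notation kappa := (condition_number Sigma).
Local Notation S := (invmx Sigma).
Local Notation f := (mixture_potential mu Sigma w).

Definition mixture_density (x : point R d) : R :=
  \sum_i w i * expR (- (qform S (col_of x - mu i) / 2)).

Local Notation u := mixture_density.

Let gm0 : 0 < gm. Proof. exact: gamma_min_gt0. Qed.

Let gmM : gm <= gM. Proof. exact: gamma_min_le_max. Qed.

Let gM0 : 0 < gM. Proof. exact: lt_le_trans gmM. Qed.

Let sS : S^T = S. Proof. exact: tr_invmx. Qed.

Lemma mixture_nonempty : exists i0 : 'I_n, True.
Proof.
case: n mu w w0 w1 => [|n'] mu' w' _ ; last by exists ord0.
by rewrite big_ord0 => /eqP; rewrite eq_sym oner_eq0.
Qed.

Lemma kappa_ge1 : 1 <= kappa.
Proof. by rewrite ler_pdivlMr// mul1r. Qed.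

Lemma radius_ge0 : 0 <= D.
Proof. by rewrite le_max sqrtr_ge0 orbT. Qed.

Lemma gamma_min_le_radius : gm <= D ^+ 2.
Proof.
rewrite -[leLHS]sqr_sqrtr ?(ltW gm0)// lerXn2r ?nnegrE ?sqrtr_ge0 ?radius_ge0//.
by rewrite le_max lexx orbT.
Qed.

Lemma radius_gt0 : 0 < D.
Proof. by rewrite lt_max sqrtr_gt0 gm0 orbT. Qed.

Lemma nsq_mean_le i : nsq (mu i) <= D ^+ 2.
Proof.
rewrite -enorm_sqr lerXn2r ?nnegrE ?sqrtr_ge0 ?radius_ge0// le_max.
by apply/orP; left; exact: le_bigmax_cond.
Qed.

Lemma min_weight_gt0 : 0 < min_weight w.
Proof. by apply: lt_bigmin. Qed.

Lemma min_weight_le i : min_weight w <= w i.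
Proof. exact: bigmin_le_cond. Qed.

Let qS0 v : 0 <= qform S v. Proof. exact: qform_inv_ge0. Qed.

Let qSm v : qform S v <= gm^-1 * nsq v.
Proof. by rewrite mulrC qform_inv_le. Qed.

Lemma measurable_mixture_density : measurable_fun setT u.
Proof.
apply: measurable_sum => i; apply: measurable_funM => //.
apply: measurableT_comp => //; apply: measurableT_comp => //.
apply: measurable_funM => //; apply: measurable_qform => j.
under eq_fun do rewrite !mxE.
by apply: measurable_funB => //; exact: measurable_tnth.
Qed.

Lemma mixture_density_gt0 x : 0 < u x.
Proof.
have [i0 _] := mixture_nonempty.
rewrite /u (bigD1 i0)//= ltr_pwDl// ?mulr_gt0 ?expR_gt0//.
by apply: sumr_ge0 => i _; rewrite mulr_ge0 ?expR_ge0// ltW.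
Qed.

Lemma mixture_density_le1 x : u x <= 1.
Proof.
rewrite -[leRHS]w1; apply: ler_sum => i _.
by rewrite ler_piMr ?(ltW (w0 i))// -expR0 ler_expR oppr_le0 divr_ge0.
Qed.

Lemma expR_mixture_potential x : expR (- f x) = u x.
Proof. by rewrite /mixture_potential opprK lnK// posrE mixture_density_gt0. Qed.

Lemma measurable_mixture_potential : measurable_fun setT f.
Proof.
apply: measurableT_comp => //; apply: measurableT_comp => //.
exact: measurable_mixture_density.
Qed.

(** Since |x - mu|^2 <= 2 (|x|^2 + |mu|^2), the factor 1/2 in the exponent is lost; this is why the
    initial covariance is half of [gamma_min]. *)
Lemma mixture_density_ge x :
  expR (- ((nsq (col_of x) + D ^+ 2) / gm)) <= u x.
Proof.
rewrite -[leLHS]mul1r -[X in X * _]w1 mulr_suml; apply: ler_sum => i _.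
rewrite ler_wpM2l ?(ltW (w0 i))// ler_expR lerN2.
apply: (@le_trans _ _ (gm^-1 * nsq (col_of x - mu i) / 2)).
  by rewrite ler_wpM2r// invr_ge0.
rewrite mulrC [leRHS]mulrC mulrCA ler_wpM2l ?invr_ge0 ?(ltW gm0)//.
have := nsqB_le (col_of x) (mu i); have := nsq_mean_le i; lra.
Qed.

(** Each component lies below an isotropic one of variance [gamma_max], whose integral factorizes;
    no change of variables is needed. *)
Lemma integral_mixture_density_le :
  (\int[leb]_x (u x)%:E <= (Num.sqrt ((2 * pi * gM) ^+ d))%:E)%E.
Proof.
set s := Num.sqrt _.
have s0 : 0 < s by rewrite sqrtr_gt0 exprn_gt0// !mulr_gt0// pi_gt0.
pose g x := \sum_i (w i * s) * gauss_pdf (mu i) gM%:M x.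
have mg i : measurable_fun setT (fun x => (w i * s) * gauss_pdf (mu i) gM%:M x).
  by apply: measurable_funM => //; exact: measurable_gauss_pdf.
have wg i x : 0 <= (w i * s) * gauss_pdf (mu i) gM%:M x.
  by rewrite !mulr_ge0 ?(ltW (gauss_pdf_gt0 _ _ _)) ?(ltW s0) ?(ltW (w0 i)).
apply: (@le_trans _ _ (\int[leb]_x (g x)%:E)%E).
  apply: ge0_le_integral => //.
  - by move=> x _; rewrite lee_fin ltW// mixture_density_gt0.
  - by apply/measurable_EFinP; exact: measurable_mixture_density.
  - by apply/measurable_EFinP; apply: measurable_sum.
  move=> x _; rewrite lee_fin; apply: ler_sum => i _; rewrite -mulrA.
  rewrite ler_wpM2l ?(ltW (w0 i))// gauss_pdf_scalar//.
  rewrite [leRHS]mulrC mulfVK ?gt_eqF//.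
  rewrite ler_expR lerN2 invfM mulrA mulrAC ler_wpM2r ?invr_ge0//.
  exact: qform_inv_ge.
under eq_integral do rewrite /g -sumEFin.
rewrite ge0_integral_sum//; last 2 first.
- by move=> i; apply/measurable_EFinP.
- by move=> i x _; rewrite lee_fin.
under eq_bigr do rewrite (eq_integral _ _ (fun x _ => EFinM _ _)).
rewrite (eq_bigr (fun i => (w i * s)%:E)); last first.
  move=> i _; rewrite ge0_integralZl//= ?integral_gauss_pdf ?mule1//.
  - by apply/measurable_EFinP; exact: measurable_gauss_pdf.
  - by move=> x _; rewrite lee_fin (ltW (gauss_pdf_gt0 _ _ _)).
  - by rewrite lee_fin mulr_ge0 ?(ltW s0) ?(ltW (w0 i)).
by rewrite sumEFin -mulr_suml w1 mul1r.
Qed.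

(** The budget behind the 15 in [core_radius]. Half of the linear gain pays for the perturbation;
    the other half is at least 15/2 BBX, while the means, the curvature and the required gain cost
    at most (3/2 + 9/8 + 2) BBX. *)
Let gain_arith (q1 p1 p2 p3 q2 g1 g2 b L BX BBX BB : R) : 0 <= BB ->
  p1 <= - (b * L) -> p2 <= b / 2 * L -> - g1 <= p3 -> q2 <= g2 ->
  g1 <= 3 / 2 * BX -> g2 <= 9 / 4 * BBX -> BX <= BBX -> BB <= BBX ->
  15 / 2 * BBX <= b / 2 * L ->
  (q1 + 2 * (p1 + p2 - p3) + q2) / 2 + 2 * BB <= q1 / 2.
Proof. lra. Qed.

(* A move of length t towards the origin, perturbed by at most delta, decreases
   every quadratic form at once, because the linear gain t|x|/gM exceeds the
   losses due to the perturbation, the means and the curvature. *)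
Lemma inward_move_gain b x y : 1 <= b ->
  let t := b * kappa * D in let delta := b * D / 2 in
  15 * b * kappa ^+ 2 * D <= enorm x ->
  nsq (y - (x - (t / enorm x) *: x)) <= delta ^+ 2 ->
  forall i, qform S (y - mu i) / 2 + 2 * b ^+ 2 * kappa ^+ 2 <=
    qform S (x - mu i) / 2.
Proof.
move=> b1 t delta; set l := enorm x => lx; set e := _ - _ => ed i.
have k1 := kappa_ge1; have D0 := radius_gt0.
have b0 : 0 < b by rewrite (lt_le_trans _ b1).
have k0 : 0 < kappa by rewrite (lt_le_trans _ k1).
have t0 : 0 < t by exact: mulr_gt0 (mulr_gt0 b0 k0) D0.
have dl0 : 0 < delta by rewrite /delta divr_gt0// mulr_gt0.
have l0 : 0 < l.
  apply: lt_le_trans lx; apply: mulr_gt0 => //; apply: mulr_gt0.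
    by apply: mulr_gt0.
  exact: exprn_gt0.
have l2 : nsq x = l ^+ 2 by rewrite enorm_sqr.
pose a := - (t / l) *: x; pose v := a + e.
have yE : y = x + v.
  by rewrite /v /a /e scaleNr; apply/matrixP => p q; rewrite !mxE; ring.
have na : nsq a <= t ^+ 2.
  by rewrite /a nsqZ sqrrN l2 expr_div_n mulfVK// expf_neq0// gt_eqF.
have nv : nsq v <= (t + delta) ^+ 2 by apply: nsqD_le => //; exact: ltW.
have ig0 : 0 <= gm^-1 by rewrite invr_ge0 ltW.
have Bmu : `|bform S (mu i) v| <= gm^-1 * D * (t + delta).
  apply: bform_le => //; [exact: radius_ge0|exact: ltW (addr_gt0 t0 dl0)|].
  exact: nsq_mean_le.
have Bxe : `|bform S x e| <= gm^-1 * l * delta.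
  by apply: bform_le => //; [exact: ltW..|rewrite l2].
have Bxa : bform S x a <= - (t * l / gM).
  rewrite /a bformZr mulNr lerN2 -[leLHS]mulrA -[leRHS]mulrA.
  rewrite ler_wpM2l ?(ltW t0)//.
  rewrite ler_pdivlMl//; apply: le_trans (qform_inv_ge d0 pS x).
  by rewrite l2 mulrA expr2.
have qv : qform S v <= gm^-1 * (t + delta) ^+ 2.
  by rewrite (le_trans (qSm v))// ler_wpM2l.
have -> : y - mu i = (x - mu i) + v by rewrite yE addrAC.
rewrite qformD//.
have -> : bform S (x - mu i) v = bform S x a + bform S x e - bform S (mu i) v.
  by rewrite bformDl bformNl /v bformDr.
move: Bmu Bxe; rewrite !ler_norml => /andP[Bmu _] /andP[_ Bxe].
pose X := D ^+ 2 / gm.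
have X1 : 1 <= X by rewrite ler_pdivlMr// mul1r gamma_min_le_radius.
(* The factor kappa in t turns gM into gm, and the 1/2 in delta makes the loss below exactly half of
   this gain. *)
have tgM : t * l / gM = b * (D * l / gm).
  by rewrite /t /condition_number; field; rewrite !gt_eqF.
have dgm : gm^-1 * l * delta = b / 2 * (D * l / gm).
  by rewrite /delta; field; rewrite gt_eqF.
have Y : 15 * b * kappa ^+ 2 * X <= D * l / gm.
  have -> : 15 * b * kappa ^+ 2 * X = 15 * b * kappa ^+ 2 * D * (D / gm).
    by rewrite /X; ring.
  have -> : D * l / gm = l * (D / gm) by ring.
  by apply: ler_wpM2r => //; apply: mulr_ge0 => //; exact: ltW.
have td : t + delta <= 3 / 2 * (b * kappa * D).
  rewrite /t /delta; have : b * D <= b * kappa * D.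
    by rewrite -mulrA ler_wpM2l ?(ltW b0)// ler_peMl// (ltW D0).
  lra.
have M1 : gm^-1 * D * (t + delta) <= 3 / 2 * (b * kappa) * X.
  apply: (@le_trans _ _ (gm^-1 * D * (3 / 2 * (b * kappa * D)))).
    by rewrite ler_wpM2l// mulr_ge0// (ltW D0).
  by rewrite /X le_eqVlt; apply/orP; left; apply/eqP; ring.
have M2 : gm^-1 * (t + delta) ^+ 2 <= 9 / 4 * (b * kappa) ^+ 2 * X.
  apply: (@le_trans _ _ (gm^-1 * (3 / 2 * (b * kappa * D)) ^+ 2)).
    rewrite ler_wpM2l// lerXn2r// nnegrE ?(ltW (addr_gt0 t0 dl0))//.
    by apply: mulr_ge0 => //; exact: ltW t0.
  by rewrite /X le_eqVlt; apply/orP; left; apply/eqP; field; rewrite gt_eqF.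
pose B := b * kappa; have B1 : 1 <= B by rewrite mulr_ege1.
have B2 : B * X <= B ^+ 2 * X.
  rewrite ler_wpM2r ?(le_trans ler01 X1)// expr2.
  by rewrite ler_peMl// (le_trans ler01 B1).
have B3 : B ^+ 2 <= B ^+ 2 * X by rewrite ler_peMr// sqr_ge0.
have Z : 15 / 2 * (B ^+ 2 * X) <= b / 2 * (D * l / gm).
  have -> : 15 / 2 * (B ^+ 2 * X) = b / 2 * (15 * b * kappa ^+ 2 * X).
    by rewrite /B; ring.
  by apply: ler_wpM2l => //; apply: mulr_ge0; rewrite ?invr_ge0// ltW.
have -> : 2 * b ^+ 2 * kappa ^+ 2 = 2 * B ^+ 2 by rewrite /B; ring.
move: M1 M2; rewrite -/B => M1 M2.
have M1' : gm^-1 * D * (t + delta) <= 3 / 2 * (B * X) by rewrite [leRHS]mulrA.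
have M2' : gm^-1 * (t + delta) ^+ 2 <= 9 / 4 * (B ^+ 2 * X).
  by rewrite [leRHS]mulrA.
rewrite tgM in Bxa; rewrite dgm in Bxe.
exact: (gain_arith _ (sqr_ge0 _) Bxa Bxe Bmu qv M1' M2' B2 B3 Z).
Qed.

(** * Moves into the core *)

Local Notation A := (dim_const R d).
Local Notation b := (shrink_const R d).
Local Notation r := (core_radius Sigma D).
Local Notation ratio := (scaled_radius Sigma D).
Local Notation esc := (escape_const Sigma).
Local Notation mixC := (mix_const Sigma D (min_weight w)).
Local Notation warm := (warmness Sigma D).
Local Notation k := (metropolis f (r ^+ 2)).
Local Notation c := (2 * b ^+ 2 * kappa ^+ 2).

Let rE : r = 15 * b * kappa ^+ 2 * D. Proof. by []. Qed.

Let AE : A = 15 * Num.sqrt (2 * pi * d%:R). Proof. by []. Qed.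

Let bE : b = 3 + d%:R * A. Proof. by []. Qed.

Let kappaE : kappa = gM / gm. Proof. by []. Qed.

Let mE : ratio = D / Num.sqrt gm. Proof. by []. Qed.

Let eE : esc = expR 1 * (A * kappa ^+ 2) ^+ d. Proof. by []. Qed.

(* Rewriting would otherwise unfold these constants to products and quotients. *)
#[local] Opaque condition_number core_radius shrink_const dim_const.
#[local] Opaque escape_const mixture_radius scaled_radius.

Let d1 : 1 <= d%:R :> R. Proof. by rewrite ler1n. Qed.

Let A1 : 1 <= A.
Proof.
rewrite AE; have : 1 <= Num.sqrt (2 * pi * d%:R) :> R.
  rewrite -[leLHS]sqrtr1 ler_wsqrtr//; have := @pi_ge2 R => p2.
  by rewrite mulr_ege1//; lra.
lra.
Qed.

Let b1 : 1 <= b.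
Proof.
have : 0 <= d%:R * A by rewrite mulr_ge0// (le_trans ler01 A1).
by rewrite bE; lra.
Qed.

Let k0 : 0 < kappa. Proof. exact: lt_le_trans kappa_ge1. Qed.

Let r0 : 0 < r.
Proof.
rewrite rE; apply: mulr_gt0 radius_gt0; apply: mulr_gt0; last exact: exprn_gt0.
by apply: mulr_gt0 => //; exact: lt_le_trans b1.
Qed.

Lemma core_radius_sqr_gt0 : 0 < r ^+ 2. Proof. exact: exprn_gt0. Qed.

Let eta0 := core_radius_sqr_gt0.

Let g0 : R := (Num.sqrt (2 * pi) * r) ^+ d.

Let pi2 : 0 < 2 * pi :> R. Proof. by rewrite mulr_gt0// pi_gt0. Qed.

Let g00 : 0 < g0. Proof. by rewrite exprn_gt0// mulr_gt0// sqrtr_gt0. Qed.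

Let gaussE (x y : point R d) : gauss_pdf (col_of x) (r ^+ 2)%:M y =
  expR (- (nsq (col_of y - col_of x) / (2 * r ^+ 2))) / g0.
Proof.
rewrite gauss_pdf_scalar//; congr (_ / _).
rewrite sqrtr_pow; last by apply: mulr_ge0; exact: ltW.
rewrite sqrtrM; last exact: ltW.
by rewrite sqrtr_sqr ger0_norm// ltW.
Qed.

Let kE (x y : point R d) : k (x, y) =
  gauss_pdf (col_of x) (r ^+ 2)%:M y * Num.min 1 (u y / u x).
Proof. by rewrite /metropolis/= !expR_mixture_potential. Qed.

Let gauss_lb (x y : point R d) a :
  nsq (col_of y - col_of x) <= 2 * a * r ^+ 2 ->
  expR (- a) / g0 <= gauss_pdf (col_of x) (r ^+ 2)%:M y.
Proof.
move=> H; rewrite gaussE ler_wpM2r ?invr_ge0 ?(ltW g00)// ler_expR lerN2.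
rewrite ler_pdivrMr; last exact: mulr_gt0 eta0.
by rewrite mulrA [a * 2]mulrC.
Qed.

Let mk := measurable_metropolis eta0 measurable_mixture_potential.
Let kge0 := metropolis_ge0 f eta0.
Let kmass := metropolis_mass eta0 measurable_mixture_potential.

Definition core_set : set (point R d) := [set x | nsq (col_of x) <= r ^+ 2].

Definition descent_set : set (point R d * point R d) :=
  [set z | expR c * u z.1 <= u z.2].

Let mcol i : measurable_fun setT (fun x : point R d => (col_of x) i 0).
Proof. by under eq_fun do rewrite mxE; exact: measurable_tnth. Qed.

Let mcore : measurable core_set.
Proof.
rewrite /core_set -[X in measurable X]setTI.
apply: measurable_fun_le => //.
exact: (measurable_nsq (g := @col_of R d)).
Qed.

Let mdescent : measurable descent_set.
Proof.
rewrite /descent_set -[X in measurable X]setTI.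
have mu1 := measurableT_comp measurable_mixture_density
  (@measurable_fst _ _ (point R d) (point R d)).
have mu2 := measurableT_comp measurable_mixture_density
  (@measurable_snd _ _ (point R d) (point R d)).
by apply: measurable_fun_le => //; apply: measurable_funM.
Qed.

Let bdescent := bmeas_indic R mdescent.

Let kint := metropolis_integrable eta0 measurable_mixture_potential.

Lemma escape_const_ge1 : 1 <= esc.
Proof.
rewrite eE; apply: mulr_ege1; first by rewrite -expR0 ler_expR.
apply: exprn_ege1; apply: mulr_ege1 => //.
by apply: exprn_ege1; exact: kappa_ge1.
Qed.

(** The condition [4 * delta <= q0] of [poincare], and the origin of [shrink_const]: 4 esc <= expR
    (3 + d A kappa^2) <= expR (b kappa^2), as 4 <= expR 2 and 1 <= kappa. *)
Lemma escape_const_le : 4 * expR (- c) <= esc^-1.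
Proof.
have e0 : 0 < esc by rewrite (lt_le_trans ltr01) ?escape_const_ge1.
rewrite expRN ler_pdivrMr ?expR_gt0// [leRHS]mulrC ler_pdivlMr// eE.
have K1 : 1 <= kappa ^+ 2 by rewrite exprn_ege1// kappa_ge1.
have Ak0 : 0 <= A * kappa ^+ 2 by rewrite mulr_ge0 ?sqr_ge0// (le_trans ler01).
have e4 : 4 <= expR 2 :> R.
  have e2 : 2 <= expR 1 :> R by have := @expR_ge1Dx R 1; lra.
  rewrite (_ : 2 = 1 + 1) // expRD (_ : 4 = 2 * 2); last by ring.
  by apply: ler_pM.
apply: (@le_trans _ _ (expR 2 * (expR 1 * expR (A * kappa ^+ 2) ^+ d))).
  apply: ler_pM => //; first by rewrite ltW.
  rewrite ler_wpM2l ?expR_ge0// lerXn2r ?nnegrE ?expR_ge0//.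
  by rewrite (le_trans _ (expR_ge1Dx _))// lerDr.
rewrite -expRM_natl -!expRD ler_expR.
have B2 : b <= 2 * b ^+ 2.
  have : b <= b ^+ 2 by rewrite expr2 ler_peMl// (le_trans ler01 b1).
  have := b1; lra.
apply: (@le_trans _ _ (b * kappa ^+ 2)); last by rewrite ler_wpM2r ?sqr_ge0.
have -> : b * kappa ^+ 2 = 3 * kappa ^+ 2 + d%:R * (A * kappa ^+ 2).
  by rewrite [X in X * _ = _]bE; ring.
have := K1; lra.
Qed.

(** A move that lowers the density by the factor expR c is accepted with probability at most expR (-
    c), wherever it is proposed. *)
Lemma ascent_rare x :
  \int[leb]_y (k (x, y) * \1_descent_set (y, x)) <= expR (- c).
Proof.
have bd : bmeas (fun y => \1_descent_set (y, x) : R).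
  exact: (bmeas_comp bdescent (measurable_pair2 x)).
have -> : expR (- c) = \int[leb]_y
    (gauss_pdf (col_of x) (r ^+ 2)%:M y * expR (- c)).
  rewrite RintegralZr//; last exact: gauss_pdf_integrable.
  by rewrite /Rintegral integral_gauss_pdf//= mul1r.
apply: le_Rintegral => //.
- exact: weighted_integrable.
- apply: (weighted_integrable (gauss_pdf_integrable _ eta0)).
  exact: bmeas_cst.
move=> y _; rewrite indicE.
have [/set_mem/= H|_] := boolP (_ \in _); last first.
  by rewrite mulr0 mulr_ge0 ?expR_ge0// ltW// gauss_pdf_gt0.
rewrite mulr1 kE ler_wpM2l ?(ltW (gauss_pdf_gt0 _ _ _))// ge_min.
apply/orP; right; rewrite ler_pdivrMr ?mixture_density_gt0//.
by rewrite expRN mulrC ler_pdivlMr ?expR_gt0// mulrC.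
Qed.

Lemma descent_often x : ~ core_set x ->
  esc^-1 <= \int[leb]_y (k (x, y) * \1_descent_set (x, y)).
Proof.
move=> /negP; rewrite -ltNge => xr.
have bd : bmeas (fun y => \1_descent_set (x, y) : R).
  exact: (bmeas_comp bdescent (measurable_pair1 x)).
have ib := weighted_integrable (kint x) bd.
have b0 : 0 < b by rewrite (lt_le_trans _ b1).
have D0 := radius_gt0.
pose t := b * kappa * D; pose delta := b * D / 2.
have t0 : 0 < t by exact: mulr_gt0 (mulr_gt0 b0 k0) D0.
have dl0 : 0 < delta by rewrite /delta divr_gt0// mulr_gt0.
set l := enorm (col_of x).
have l2 : nsq (col_of x) = l ^+ 2 by rewrite enorm_sqr.
have lr : r <= l.
  rewrite -(@ler_pXn2r _ 2) ?nnegrE ?sqrtr_ge0 ?(ltW r0)//.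
  by rewrite -l2 ltW.
have l0 : 0 < l by rewrite (lt_le_trans r0).
(* The cube of half-side s is inscribed in the ball of radius delta. *)
pose s := delta / Num.sqrt d%:R.
have sd0 : 0 < Num.sqrt d%:R :> R by rewrite sqrtr_gt0 ltr0n.
have s0 : 0 <= s by rewrite divr_ge0// ltW.
have qE : esc^-1 = expR (- 1) / g0 * (2 * s) ^+ d.
  rewrite eE invfM expRN -mulrA; congr (_ * _).
  rewrite /g0 -!exprVn -exprMn; congr (_ ^+ _).
  rewrite /s /delta rE AE (@sqrtrM _ (2 * pi)) ?(ltW pi2)//; field.
  by rewrite !gt_eqF// sqrtr_gt0.
rewrite -lee_fin qE /Rintegral fineK; last exact: (integrable_fin_num _ ib).
apply: (box_lower_bound (v := col_of x - (t / l) *: col_of x)) => //.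
- by rewrite divr_ge0 ?expR_ge0// ltW.
- by apply/measurable_EFinP; exact: (measurable_int _ ib).
- by move=> y; rewrite mulr_ge0// indicE.
move=> y yb.
have ny : nsq (col_of y - (col_of x - (t / l) *: col_of x)) <= delta ^+ 2.
  have -> : delta ^+ 2 = d%:R * s ^+ 2.
    rewrite /s (expr_div_n delta (Num.sqrt _)) sqr_sqrtr ?ler0n//.
    rewrite mulrCA mulfV ?mulr1//.
    by rewrite gt_eqF// ltr0n.
  by apply: nsq_box_le => // i; have := yb i; rewrite !mxE.
have gain := inward_move_gain b1 lr ny.
have uxy : expR c * u x <= u y.
  rewrite mulr_sumr; apply: ler_sum => i _.
  rewrite mulrCA ler_wpM2l ?(ltW (w0 i))//.
  by rewrite -expRD ler_expR; have := gain i; lra.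
rewrite indicE mem_set//= mulr1 kE.
have c0 : 0 <= c by rewrite mulr_ge0 ?sqr_ge0// mulr_ge0 ?sqr_ge0.
rewrite (_ : Num.min _ _ = 1) ?mulr1; last first.
  apply/min_idPl; rewrite ler_pdivlMr ?mixture_density_gt0// mul1r.
  apply: le_trans uxy; rewrite ler_peMl ?(ltW (mixture_density_gt0 _))//.
  by rewrite -[leLHS]expR0 ler_expR.
(* The move has length at most t + delta <= r, so the Gaussian exponent costs at most the factor
   expR (- 1). *)
apply: gauss_lb; apply: (@le_trans _ _ ((t + delta) ^+ 2)).
  have -> : col_of y - col_of x = - (t / l) *: col_of x +
      (col_of y - (col_of x - (t / l) *: col_of x)).
    by rewrite scaleNr; apply/matrixP => p q; rewrite !mxE; ring.
  apply: nsqD_le => //; try exact: ltW.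
  by rewrite nsqZ sqrrN l2 expr_div_n mulfVK// expf_neq0// gt_eqF.
apply: (@le_trans _ _ (r ^+ 2)); last first.
  by rewrite mulr1 ler_peMl ?sqr_ge0// ler1n.
apply: lerXn2r; rewrite ?nnegrE ?(ltW r0) ?(ltW (addr_gt0 t0 dl0))//.
have bk : b * D <= b * kappa ^+ 2 * D.
  rewrite ler_wpM2r ?(ltW D0)// ler_peMr ?(ltW b0)//.
  by rewrite exprn_ege1// kappa_ge1.
have bk2 : b * kappa * D <= b * kappa ^+ 2 * D.
  rewrite ler_wpM2r ?(ltW D0)// ler_wpM2l ?(ltW b0)//.
  by rewrite expr2 ler_peMl ?kappa_ge1// ltW.
have bk3 : 0 < b * D by exact: mulr_gt0.
have -> : r = 15 * (b * kappa ^+ 2 * D) by rewrite rE; ring.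
rewrite /t /delta; lra.
Qed.

(** * Core mass, minorization and spectral gap *)

Let iu : leb.-integrable setT (EFin \o u).
Proof.
apply: ge0_integrable.
- exact: measurable_mixture_density.
- by move=> x; exact: ltW (mixture_density_gt0 x).
- by rewrite (le_lt_trans integral_mixture_density_le)// ltey.
Qed.

Definition partition_function : R := \int[leb]_x u x.

Local Notation Z := partition_function.
Local Notation p := (target_pdf f).

Let ZE : (\int[leb]_x (u x)%:E = Z%:E)%E.
Proof. by rewrite /Z /Rintegral fineK//; exact: (integrable_fin_num _ iu). Qed.

Let pE x : p x = u x / Z.
Proof.
rewrite /target_pdf expR_mixture_potential; congr (_ / fine _).
by apply: eq_integral => y _; rewrite expR_mixture_potential.
Qed.

Let s0 : R := Num.sqrt gm / Num.sqrt d%:R.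

Let sgm0 : 0 < Num.sqrt gm. Proof. by rewrite sqrtr_gt0. Qed.

Let sd0 : 0 < Num.sqrt d%:R :> R. Proof. by rewrite sqrtr_gt0 ltr0n. Qed.

Let s00 : 0 < s0. Proof. exact: divr_gt0. Qed.

Let bcore := bmeas_indic R mcore.

(** One component suffices: the cube around its mean lies within sqrt gm of it, hence within 2 D <=
    r of the origin, and the exponent there is at least -1/2. *)
Lemma core_mass_ge : min_weight w * expR (- (1 / 2)) * (2 * s0) ^+ d <=
  \int[leb]_x (u x * \1_core_set x).
Proof.
have [i0 _] := mixture_nonempty.
have ib := weighted_integrable iu bcore.
rewrite -lee_fin (EFin_weighted iu bcore).
apply: (box_lower_bound (v := mu i0)).
- exact: ltW.
- by rewrite mulr_ge0 ?expR_ge0// ltW// min_weight_gt0.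
- by apply/measurable_EFinP; exact: (measurable_int _ ib).
- by move=> x; rewrite mulr_ge0 ?(ltW (mixture_density_gt0 _))// indicE.
move=> x xb.
have nx : nsq (col_of x - mu i0) <= Num.sqrt gm ^+ 2.
  have -> : Num.sqrt gm ^+ 2 = d%:R * s0 ^+ 2.
    rewrite /s0 (expr_div_n (Num.sqrt gm) (Num.sqrt _)) (@sqr_sqrtr _ d%:R)//.
    by rewrite mulrCA mulfV ?mulr1// gt_eqF// ltr0n.
  apply: nsq_box_le; first exact: ltW.
  by move=> i; have := xb i; rewrite !mxE.
have D0 := radius_gt0.
rewrite indicE mem_set ?mulr1; last first.
  rewrite /core_set/= -[col_of x](subrK (mu i0)).
  apply: (@le_trans _ _ ((Num.sqrt gm + D) ^+ 2)).
    by apply: nsqD_le; [exact: ltW|exact: ltW|exact: nx|exact: nsq_mean_le].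
  apply: lerXn2r; rewrite ?nnegrE ?(ltW r0) ?(ltW (addr_gt0 sgm0 D0))//.
  have gD : Num.sqrt gm <= D.
    rewrite -(@ler_pXn2r _ 2) ?nnegrE ?(ltW sgm0) ?(ltW D0)//.
    by rewrite sqr_sqrtr ?(ltW gm0)// gamma_min_le_radius.
  have bk : D <= b * kappa ^+ 2 * D.
    apply: ler_peMl; first exact: ltW.
    by apply: mulr_ege1 => //; apply: exprn_ege1; exact: kappa_ge1.
  have -> : r = 15 * (b * kappa ^+ 2 * D) by rewrite rE; ring.
  lra.
rewrite /u (bigD1 i0)//= -[leLHS]addr0; apply: lerD; last first.
  by apply: sumr_ge0 => i _; rewrite mulr_ge0 ?expR_ge0// ltW.
apply: ler_pM; rewrite ?expR_ge0 ?(ltW min_weight_gt0) ?min_weight_le//.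
rewrite ler_expR lerN2 ler_wpM2r// (le_trans (qSm _))// ler_pdivrMl// mulr1.
by rewrite (le_trans nx)// sqr_sqrtr// ltW.
Qed.

Let Y : R := min_weight w * expR (- (1 / 2)) * (2 * s0) ^+ d.

Let Y0 : 0 < Y.
Proof.
apply: mulr_gt0.
  by apply: mulr_gt0; [exact: min_weight_gt0|exact: expR_gt0].
by apply: exprn_gt0; apply: mulr_gt0.
Qed.

Lemma partition_function_gt0 : 0 < Z.
Proof.
apply: (lt_le_trans Y0); apply: (le_trans core_mass_ge).
apply: le_Rintegral => //; first exact: weighted_integrable.
by move=> x _; rewrite ler_piMr ?(ltW (mixture_density_gt0 _)).
Qed.

Let Z0 := partition_function_gt0.

Let p0 x : 0 < p x.
Proof. by rewrite pE divr_gt0// mixture_density_gt0. Qed.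

Let p0' x : 0 <= p x. Proof. exact: ltW. Qed.

Let mp : measurable_fun setT p.
Proof.
rewrite (_ : p = fun x => u x * Z^-1); last by apply/funext => x; rewrite pE.
by apply: measurable_funM => //; exact: measurable_mixture_density.
Qed.

Let p1 : (\int[leb]_x (p x)%:E = 1)%E.
Proof.
under eq_integral do rewrite pE mulrC EFinM.
rewrite ge0_integralZl//=; last 3 first.
- by apply/measurable_EFinP; exact: measurable_mixture_density.
- by move=> x _; rewrite lee_fin ltW// mixture_density_gt0.
- by rewrite lee_fin invr_ge0 ltW.
by rewrite ZE -EFinM mulVf// gt_eqF.
Qed.

Let ip : leb.-integrable setT (EFin \o p).
Proof. by apply: ge0_integrable => //; rewrite p1 ltey. Qed.

Let balance x y : p x * k (x, y) = p y * k (y, x).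
Proof.
have H a c : 0 < a -> 0 < c -> a * Num.min 1 (c / a) = Num.min a c :> R.
  move=> a0 c0; rewrite minr_pMr ?(ltW a0)// mulr1.
  by rewrite mulrCA mulfV ?mulr1// gt_eqF.
have ux := mixture_density_gt0 x; have uy := mixture_density_gt0 y.
have gC : gauss_pdf (col_of x) (r ^+ 2)%:M y =
    gauss_pdf (col_of y) (r ^+ 2)%:M x.
  by rewrite !gaussE -[col_of y - _]opprB nsqN.
rewrite !kE !pE gC; set g := gauss_pdf _ _ _.
transitivity (g / Z * (u x * Num.min 1 (u y / u x))); first by ring.
transitivity (g / Z * (u y * Num.min 1 (u x / u y))); last by ring.
by rewrite !H// minC.
Qed.

Let c0 : R := Z * (expR (- 2) / g0).

Let c00 : 0 < c0.
Proof. by apply: mulr_gt0 => //; apply: divr_gt0 => //; exact: expR_gt0. Qed.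

(** Two core points are at distance at most 2 r, which gives expR (- 2); as 0 < u <= 1, the
    acceptance probability is at least u y. *)
Let core_minor x y : core_set x -> core_set y -> c0 * p y <= k (x, y).
Proof.
move=> cx cy.
have ux := mixture_density_gt0 x; have uy := mixture_density_gt0 y.
have -> : c0 * p y = expR (- 2) / g0 * u y.
  by rewrite /c0 pE; field; rewrite !gt_eqF.
rewrite kE; apply: ler_pM.
- by apply: divr_ge0; [exact: expR_ge0|exact: ltW].
- exact: ltW.
- apply: gauss_lb; apply: (le_trans (nsqB_le _ _)).
  move: cx cy; rewrite /core_set/=; lra.
rewrite le_min mixture_density_le1/= ler_pdivlMr// ler_piMr ?(ltW uy)//.
exact: mixture_density_le1.
Qed.

Let coreE : \int[leb]_x (p x * \1_core_set x) =
  Z^-1 * \int[leb]_x (u x * \1_core_set x).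
Proof.
rewrite -(weightedZ iu _ bcore); apply: eq_Rintegral => x _.
by rewrite pE; ring.
Qed.

Let core_gt0 : 0 < \int[leb]_x (p x * \1_core_set x).
Proof.
by rewrite coreE mulr_gt0 ?invr_gt0//; exact: lt_le_trans core_mass_ge.
Qed.

(** The partition function cancels between the core mass and [c0], so only the unnormalized mass has
    to be bounded below. *)
Let mix_const_ge : 4 / esc^-1 +
  2 / (\int[leb]_x (p x * \1_core_set x) * c0) <= mixC.
Proof.
rewrite invrK lerD2l ler_wpM2l//.
have YE : \int[leb]_x (p x * \1_core_set x) * c0 =
    \int[leb]_x (u x * \1_core_set x) * (expR (- 2) / g0).
  by rewrite coreE /c0; field; rewrite !gt_eqF.
rewrite YE; set I := \int[leb]_x _.
have e2 : 0 < expR (- 2) / g0 by apply: divr_gt0 => //; exact: expR_gt0.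
apply: (@le_trans _ _ (Y * (expR (- 2) / g0))^-1).
  rewrite lef_pV2 ?posrE; last 2 first.
  - by apply: mulr_gt0 => //; exact: lt_le_trans core_mass_ge.
  - exact: mulr_gt0.
  by rewrite ler_pM2r// core_mass_ge.
have -> : (Y * (expR (- 2) / g0))^-1 =
    expR (5 / 2) / min_weight w * (g0 / (2 * s0) ^+ d).
  have -> : 5 / 2 = 1 / 2 + 2 :> R by field.
  have s1 : 0 < (2 * s0) ^+ d by apply: exprn_gt0; exact: mulr_gt0.
  have wm0 := min_weight_gt0.
  by rewrite expRD /Y !expRN; field; rewrite !gt_eqF// expR_gt0.
rewrite ler_wpM2l ?divr_ge0 ?expR_ge0 ?(ltW min_weight_gt0)//.
have m0 : 0 < ratio by apply: divr_gt0 => //; exact: radius_gt0.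
rewrite /g0 -expr_div_n; apply: lerXn2r; rewrite ?nnegrE.
- apply: divr_ge0; apply: mulr_ge0 => //; exact: ltW.
- have [A0 bb0] := (lt_le_trans ltr01 A1, lt_le_trans ltr01 b1).
  by apply: ltW; do 2 apply: mulr_gt0 => //; [exact: mulr_gt0|exact: exprn_gt0].
have -> : Num.sqrt (2 * pi) * r / (2 * s0) =
    2^-1 * (A * b * kappa ^+ 2 * ratio).
  rewrite rE AE (@sqrtrM _ (2 * pi)) ?(ltW pi2)// mE /s0; field.
  by rewrite !gt_eqF.
rewrite ler_piMl//; last by rewrite invf_le1// ler1n.
have [A0 bb0] := (lt_le_trans ltr01 A1, lt_le_trans ltr01 b1).
by apply: ltW; do 2 apply: mulr_gt0 => //; [exact: mulr_gt0|exact: exprn_gt0].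
Qed.

Lemma mix_const_ge1 : 1 <= mixC.
Proof.
have e1 := escape_const_ge1; rewrite /mix_const.
set B := 2 * _; have : 0 <= B; last lra.
apply: mulr_ge0 => //; apply: mulr_ge0.
  by apply: divr_ge0; [exact: expR_ge0|exact: ltW min_weight_gt0].
have m0 : 0 < ratio by apply: divr_gt0 => //; exact: radius_gt0.
have [A0 bb0] := (lt_le_trans ltr01 A1, lt_le_trans ltr01 b1).
apply: exprn_ge0.
by apply: ltW; do 2 apply: mulr_gt0 => //; [exact: mulr_gt0|exact: exprn_gt0].
Qed.

Lemma mixture_spectral_gap M (phi : point R d -> R) : measurable_fun setT phi ->
  (forall x, 0 <= phi x <= M) -> \int[leb]_x (p x * phi x) = 1 ->
  deviation leb p phi <= mixC * dirichlet leb p k phi.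
Proof.
move=> mphi phiM phi1.
have e0 : 0 < esc^-1.
  by rewrite invr_gt0 (lt_le_trans ltr01) ?escape_const_ge1.
have := poincare mp p0' p1 mk kge0 kmass balance mcore mdescent c00 e0
  escape_const_le core_gt0 core_minor descent_often ascent_rare mphi phiM phi1.
move=> H; apply: (le_trans H); rewrite ler_wpM2r//.
apply: Rintegral_ge0 => z _; apply: mulr_ge0; last exact: sqr_ge0.
by rewrite mulr_ge0.
Qed.

(** * Initial density, output law and running time *)

Let half_gm : 0 < gm / 2. Proof. exact: divr_gt0. Qed.

Local Notation h := (fun x => gauss_pdf 0 (gm / 2)%:M x / p x).

Let mh : measurable_fun setT h.
Proof.
rewrite (_ : h = fun x => gauss_pdf 0 (gm / 2)%:M x * (Z * expR (f x))).
  apply: measurable_funM; first exact: measurable_gauss_pdf.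
  apply: measurable_funM => //; apply: measurableT_comp => //.
  exact: measurable_mixture_potential.
apply/funext => x; congr (_ * _).
by rewrite pE invfM invrK mulrC -[f x]opprK expRN expR_mixture_potential.
Qed.

(** The Gaussian exponent -|x|^2 / gm is the one in [mixture_density_ge], so x drops out of the
    ratio; the square root bounds the quotient of the normalizing constants. *)
Let hM x : 0 <= h x <= warm.
Proof.
apply/andP; split.
  by apply: divr_ge0 => //; exact: ltW (gauss_pdf_gt0 _ _ _).
have D0 := radius_gt0.
have g1 : 0 < Num.sqrt ((pi * gm) ^+ d).
  by rewrite sqrtr_gt0; apply: exprn_gt0; apply: mulr_gt0 => //; exact: pi_gt0.
have ZM : Z <= Num.sqrt ((2 * pi * gM) ^+ d).
  by rewrite -lee_fin -ZE integral_mixture_density_le.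
have qM : Num.sqrt ((2 * kappa) ^+ d) * Num.sqrt ((pi * gm) ^+ d) =
    Num.sqrt ((2 * pi * gM) ^+ d).
  rewrite -sqrtrM; last by apply: exprn_ge0; apply: mulr_ge0 => //; exact: ltW.
  rewrite -exprMn kappaE; congr (Num.sqrt (_ ^+ _)); field.
  by rewrite gt_eqF.
rewrite ler_pdivrMr// gauss_pdf_scalar// subr0.
have -> : 2 * (gm / 2) = gm by field.
have -> : 2 * pi * (gm / 2) = pi * gm by field.
rewrite ler_pdivrMr// pE.
have ub : expR (- (nsq (col_of x) / gm)) <= expR (ratio ^+ 2) * u x.
  apply: (@le_trans _ _ (expR (ratio ^+ 2) *
      expR (- ((nsq (col_of x) + D ^+ 2) / gm)))); last first.
    by apply: ler_wpM2l; [exact: expR_ge0|exact: mixture_density_ge].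
  rewrite -expRD ler_expR mE expr_div_n sqr_sqrtr ?(ltW gm0)//.
  by rewrite mulrDl opprD; lra.
apply: (le_trans ub).
have -> : warm * (u x / Z) * Num.sqrt ((pi * gm) ^+ d) =
    expR (ratio ^+ 2) * u x * (Num.sqrt ((2 * pi * gM) ^+ d) / Z).
  by rewrite -qM /warmness; ring.
apply: ler_peMr; last by rewrite ler_pdivlMr// mul1r.
by apply: mulr_ge0; [exact: expR_ge0|exact: ltW (mixture_density_gt0 _)].
Qed.

Let ph x : p x * h x = gauss_pdf 0 (gm / 2)%:M x.
Proof. by rewrite mulrC mulfVK// gt_eqF. Qed.

Let h1 : \int[leb]_x (p x * h x) = 1.
Proof.
under eq_Rintegral do rewrite ph.
by rewrite /Rintegral integral_gauss_pdf.
Qed.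

Section run.
Variables (eps : R) (N : nat).
Hypothesis eps0 : 0 < eps.
Hypothesis long : (1 - (4 * mixC)^-1) ^+ N * warm ^+ 2 <= eps ^+ 2.

Local Notation P := (one_level d (r ^+ 2) (gm / 2) N).
Local Notation hN := (iter N (lazy_step leb k) h).

Let gap (phi : point R d -> R) : measurable_fun setT phi ->
  (forall x, 0 <= phi x <= warm) -> \int[leb]_x (p x * phi x) = 1 ->
  deviation leb p phi <= mixC * dirichlet leb p k phi.
Proof. exact: mixture_spectral_gap. Qed.

Let hNP := iter_lazy_step mk kge0 kmass N mh hM.

Let bhN : bmeas hN. Proof. by have [mN NM] := hNP; exact: bmeas_ge0 NM. Qed.

(** The left side is the value of the algorithm at [phi]; hence p times [hN] is the density of the
    output. *)
Let iter_value M (phi : point R d -> R) : measurable_fun setT phi ->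
  (forall x, 0 <= phi x <= M) ->
  (\int[leb]_x (gauss_pdf 0 (gm / 2)%:M x * iter N (lazy_step leb k) phi x)%:E =
   \int[leb]_x (p x * (hN x * phi x))%:E)%E.
Proof.
move=> mphi phiM; have bphi := bmeas_ge0 mphi phiM.
have [mn nM] := iter_lazy_step mk kge0 kmass N mphi phiM.
have bn := bmeas_ge0 mn nM; have bh := bmeas_ge0 mh hM.
rewrite -(EFin_weighted ip (bmeasM bhN bphi)).
rewrite -(iter_lazy_step_selfadjoint mp p0' p1 mk kge0 kmass balance
  mh hM N mphi phiM).
rewrite (EFin_weighted ip (bmeasM bh bn)).
by apply: eq_integral => x _; rewrite mulrA ph.
Qed.

Lemma one_level_generates :
  generates_within (stmh_algorithm f P) (target_pdf f) eps.
Proof.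
have [mN NM] := hNP.
exists (fun x => p x * hN x); split.
- exact: measurable_funM.
- by move=> x; apply: mulr_ge0 => //; have /andP[] := NM x.
- rewrite -(EFin_weighted ip bhN).
  by rewrite (iter_lazy_step_mass mp p0' p1 mk kge0 kmass balance mh hM h1).
- move=> A mA; have mi : measurable_fun setT (\1_A : point R d -> R).
    exact: measurable_indic.
  have i01 x : 0 <= (\1_A x : R) <= 1.
    by rewrite indicE; case: (_ \in _); rewrite /= ?lexx ?ler01.
  rewrite /prob (stmh_algorithm_value eta0 half_gm measurable_mixture_potential
    (phi := \1_A) mi i01); last first.
    by move=> y; rewrite !indicE; congr ((_ : bool)%:R%:E); apply/idP/idP;
      rewrite !inE.
  rewrite (iter_value mi i01) [RHS]integral_mkcond/=.
  apply: eq_integral => x _; rewrite patchE indicE.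
  by case: (x \in A); rewrite ?mulr1 ?mulr0.
have bd := bmeas_norm (bmeasB bhN (bmeas_cst _ 1)).
have E : (\int[leb]_x `|p x * hN x - p x|%:E =
    (\int[leb]_x (p x * `|hN x - 1|))%:E)%E.
  rewrite (EFin_weighted ip bd); apply: eq_integral => x _.
  by rewrite -{2}[p x]mulr1 -mulrBr normrM (ger0_norm (p0' x)).
rewrite E lee_fin -(@ler_pXn2r _ 2)// ?nnegrE ?(ltW eps0)//; last first.
  by apply: Rintegral_ge0 => x _; apply: mulr_ge0.
apply: le_trans long.
exact: (tv_iter mp p0' p1 mk kge0 kmass balance mix_const_ge1 mh hM h1 gap).
Qed.

(** The step count is always N, so the event has the value of the constant test function 1, which is
    the total mass 1. *)
Lemma one_level_runs_in_time (T : R) : N%:R <= T ->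
  runs_in_time (stmh_algorithm f P) T eps.
Proof.
move=> NT; have i01 (x : point R d) : 0 <= (1 : R) <= 1 by rewrite ler01 lexx.
have m1 : measurable_fun setT (fun _ : point R d => 1 : R).
  exact: measurable_cst.
rewrite /runs_in_time /prob.
rewrite (stmh_algorithm_value eta0 half_gm measurable_mixture_potential m1 i01).
  rewrite (iter_value m1 i01).
  under eq_integral do rewrite mulr1.
  rewrite -(EFin_weighted ip bhN).
  rewrite (iter_lazy_step_mass mp p0' p1 mk kge0 kmass balance mh hM h1).
  by rewrite lee_fin gerBl ltW.
by move=> y; rewrite indicE mem_set.
Qed.

End run.

Lemma warmness_sqr : warm ^+ 2 <= expR (2 * ratio ^+ 2 + 2 * d%:R * kappa).
Proof.
have k20 : 0 <= 2 * kappa by apply: mulr_ge0 => //; exact: ltW.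
rewrite /warmness exprMn sqr_sqrtr; last exact: exprn_ge0.
rewrite expRD -expRM_natl; apply: ler_pM.
- exact: expR_ge0.
- exact: exprn_ge0.
- by rewrite lexx.
rewrite [2 * d%:R]mulrC -mulrA expRM_natl.
apply: lerXn2r; rewrite ?nnegrE ?expR_ge0//.
by apply: le_trans (expR_ge1Dx _); rewrite lerDr.
Qed.

Lemma mixing_time_long (eps L : R) N : 0 < eps -> expR (- L) <= eps ->
  4 * mixC * (2 * ratio ^+ 2 + 2 * d%:R * kappa + 2 * L) <= N%:R ->
  (1 - (4 * mixC)^-1) ^+ N * warm ^+ 2 <= eps ^+ 2.
Proof.
move=> eps0 Le HN; have G1 := mix_const_ge1.
have G0 : 0 < 4 * mixC by rewrite mulr_gt0// (lt_le_trans ltr01).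
set G := 4 * mixC in G0 HN *.
have rho0 : 0 <= 1 - G^-1.
  by rewrite subr_ge0 invf_le1// /G; lra.
apply: (@le_trans _ _ (expR (- L) ^+ 2)); last first.
  by apply: lerXn2r; rewrite ?nnegrE ?expR_ge0 ?(ltW eps0).
apply: (@le_trans _ _ (expR (- G^-1) ^+ N *
    expR (2 * ratio ^+ 2 + 2 * d%:R * kappa))).
  apply: ler_pM; [exact: exprn_ge0|exact: sqr_ge0| |exact: warmness_sqr].
  by apply: lerXn2r; rewrite ?nnegrE ?expR_ge0// (le_trans _ (expR_ge1Dx _)).
rewrite -!expRM_natl -expRD ler_expR.
have : 2 * ratio ^+ 2 + 2 * d%:R * kappa + 2 * L <= N%:R / G.
  by rewrite ler_pdivlMr// mulrC.
rewrite mulrN; lra.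
Qed.

End mixture_density.

(** * Running time *)

Section time_polynomial.
Variables (R : realType) (d : nat).

Local Notation cst x := (x%:P%:P%:P : {poly {poly {poly R}}}).

(** In the order of [eval3], the outer variable ['X] stands for 1 / wmin, ['X%:P] for the scaled
    radius and ['X%:P%:P] for kappa. *)
Definition mix_poly : {poly {poly {poly R}}} :=
  cst (4 * expR 1) * (cst (dim_const R d) * 'X%:P%:P ^+ 2) ^+ d +
  cst (2 * expR (5 / 2)) * 'X *
    (cst (dim_const R d * shrink_const R d) * 'X%:P%:P ^+ 2 * 'X%:P) ^+ d.

Definition time_poly : {poly {poly {poly R}}} :=
  cst 4 * mix_poly *
    (cst 16 * 'X%:P ^+ 2 + cst (16 * d%:R) * 'X%:P%:P + cst 8) + cst 8.

Let eval3E (a m k : R) : eval3 time_poly a m k =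
  4 * (4 * expR 1 * (dim_const R d * k ^+ 2) ^+ d + 2 * expR (5 / 2) * a *
    (dim_const R d * shrink_const R d * k ^+ 2 * m) ^+ d) *
  (16 * m ^+ 2 + 16 * d%:R * k + 8) + 8.
Proof.
rewrite /eval3 /time_poly /mix_poly.
by rewrite !(hornerD, hornerM, horner_exp, hornerC, hornerX).
Qed.

Lemma eval3_time_poly (Sigma : 'M[R]_d) (D wmin : R) :
  let m := scaled_radius Sigma D in let kappa := condition_number Sigma in
  eval3 time_poly (1 / wmin) m kappa =
  4 * mix_const Sigma D wmin * (16 * m ^+ 2 + 16 * d%:R * kappa + 8) + 8.
Proof. by rewrite /= eval3E /mix_const /escape_const div1r !mulrA. Qed.

Lemma ln2_ge_half : 2^-1 <= ln 2 :> R.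
Proof.
have := @le_ln1Dx R (- 2^-1); rewrite (_ : 1 + _ = 2^-1); last by field.
by rewrite lnV ?posrE// => /(_ _)-H; rewrite -lerN2; apply: H; lra.
Qed.

Lemma mixing_time_poly (Sigma : 'M[R]_d) (D wmin eps : R) :
  0 <= mix_const Sigma D wmin -> 0 <= condition_number Sigma ->
  (mixing_time Sigma D wmin eps)%:R <=
  eval3 time_poly (1 / wmin) (scaled_radius Sigma D) (condition_number Sigma) *
    ln (Num.max 2 (1 / eps)) ^+ 3.
Proof.
move=> G0 k0; rewrite eval3_time_poly /mixing_time.
set G := mix_const _ _ _ in G0 *; set m := scaled_radius _ _.
set k := condition_number _ in k0 *; set L := ln _.
have L2 : 2^-1 <= L.
  apply: (le_trans ln2_ge_half); rewrite ler_ln ?posrE ?lt_max ?ltr0n//.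
  by rewrite le_max lexx.
have L0 : 0 <= L by lra.
have T0 : 0 <= 2 * m ^+ 2 + 2 * d%:R * k.
  by apply: addr_ge0; apply: mulr_ge0 => //; exact: sqr_ge0.
have S0 : 0 <= 2 * m ^+ 2 + 2 * d%:R * k + 2 * L.
  by apply: addr_ge0 => //; exact: mulr_ge0.
have G40 : 0 <= 4 * G by exact: mulr_ge0.
rewrite -natr1.
apply: (@le_trans _ _ (4 * G * (2 * m ^+ 2 + 2 * d%:R * k + 2 * L) + 1)).
  rewrite lerD2r truncn_le//; exact: mulr_ge0.
(* From 1/2 <= L follow L <= 4 L^3 and 1 <= 8 L^3, which absorb the terms free of L, the term 2 L
   and the rounding 1; hence the coefficients 16, 8 and 8 of [time_poly]. *)
have LL : 1 <= 4 * L ^+ 2 by have := ler_pM _ _ L2 L2; rewrite -expr2; lra.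
have L3 : L <= 4 * L ^+ 3.
  have -> : 4 * L ^+ 3 = 4 * L ^+ 2 * L by ring.
  by rewrite -[leLHS]mul1r ler_wpM2r.
have L31 : 1 <= 8 * L ^+ 3 by lra.
rewrite [leRHS]mulrDl; apply: lerD => //.
rewrite -[leRHS]mulrA; apply: ler_wpM2l => //.
rewrite [leRHS]mulrDl; apply: lerD; last by lra.
have := ler_wpM2l T0 L31; lra.
Qed.

End time_polynomial.

Theorem theorem5 (R : realType) (d : nat) (hd : (0 < d)%N) :
  exists (poly3 : {poly {poly {poly R}}})
         (par : 'M[R]_d -> R -> R -> R -> stmh_params R d),
  forall (n : nat) (mu : 'I_n -> 'cV[R]_d) (Sigma : 'M[R]_d) (w : 'I_n -> R)
         (eps : R),
    posdef Sigma -> (forall i, 0 < w i) -> \sum_i w i = 1 -> 0 < eps ->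
    let f := mixture_potential mu Sigma w in
    let D := mixture_radius mu Sigma in
    let wmin := min_weight w in
    let kappa := condition_number Sigma in
    let P := par Sigma D wmin eps in
    [/\ valid_params P,
        generates_within (stmh_algorithm f P) (target_pdf f) eps &
        runs_in_time (stmh_algorithm f P)
          (eval3 poly3 (1 / wmin) (D / Num.sqrt (gamma_min Sigma)) kappa *
           ln (Num.max 2 (1 / eps)) ^+ 3)
          eps].
Proof.
exists (time_poly R d).
exists (fun Sigma D wmin eps => one_level d (core_radius Sigma D ^+ 2)
  (gamma_min Sigma / 2) (mixing_time Sigma D wmin eps)).
move=> n mu Sigma w eps pS w0 w1 eps0 f D wmin kappa P.
have gm0 := gamma_min_gt0 hd pS.
have k1 : 1 <= kappa := kappa_ge1 hd pS.
have D0 : 0 < D := radius_gt0 mu hd pS.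
have G1 : 1 <= mix_const Sigma D wmin := mix_const_ge1 mu hd pS w0.
have long : (1 - (4 * mix_const Sigma D wmin)^-1) ^+
    mixing_time Sigma D wmin eps * warmness Sigma D ^+ 2 <= eps ^+ 2.
  apply: (mixing_time_long hd pS w0 (L := ln (Num.max 2 (1 / eps)))) => //;
    last by rewrite ltW// truncnS_gt.
  (* With L the logarithm of this maximum, expR (- L) is its inverse, hence at most eps. *)
  have M0 : 0 < Num.max 2 (1 / eps) by rewrite lt_max ltr0n.
  rewrite expRN lnK ?posrE// -[leRHS]invrK lef_pV2 ?posrE ?invr_gt0//.
  by rewrite le_max div1r lexx orbT.
split; last 2 first.
- exact: one_level_generates.
- apply: one_level_runs_in_time => //.
  by apply: mixing_time_poly; [exact: le_trans G1|exact: le_trans k1].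
split => //=.
- split=> // i; by case: i => [|[]].
- exact: core_radius_sqr_gt0.
- by rewrite invr_gt0 invf_lt1 ?ltr0n// ltr1n.
- split=> [|v v0]; first exact: tr_scalar_mx.
  by rewrite qform_scalar mulr_gt0 ?nsq_gt0// divr_gt0.
Qed.
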